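(* Let $H$ be a closed subgroup of $\mathbb{R}^d$ with $\mathrm{codim}(H)=1$ and let $A\subset\mathbb{R}^d/H$ be a closed $\Omega$-space. Let $\gamma_1,\gamma_2\in L(H)$. The cocycle $u^{\gamma_1,\gamma_2}$ is admissible if and only if $\gamma_1$ and $\gamma_2$ are linearly dependent. Therefore, $$H^1_a(\Omega,\mathcal{L}_A)=\{[u^{\gamma_1,\gamma_2}]:\gamma_1,\gamma_2\in L(H),\ \gamma_1,\gamma_2\text{ are linearly dependent}\}.$$
   Context: $d\ge2$; $P\subset\mathbb{R}^d$ is a closed convex cone with $P-P=\mathbb{R}^d$ and $P\cap-P=\{0\}$; $\Omega$ is its interior. $L(H)$ is the real linear span of $H$ (linear dependence is over $\mathbb{R}$) and $\mathrm{codim}(H)$ is the codimension of $L(H)$ in $\mathbb{R}^d$. $\mathbb{R}^d$ acts on $\mathbb{R}^d/H$ by translation, and $\mathbb{R}^d/H$ carries Haar measure. A closed $\Omega$-space is a closed subset $A\subset\mathbb{R}^d/H$ with $A\neq\emptyset$, $A\ne\mathbb{R}^d/H$ and $A+\Omega\subset A$. $\mathcal{L}_A$ is the space of Borel functions $f:A\to\mathbb{C}$ (modulo a.e. equality) with $\int_{A\setminus(A+b)}|f(x)|^2dx<\infty$ for every $b\in\Omega$, topologized by the seminorms $\|f\|_b=(\int_{A\setminus(A+b)}|f|^2)^{1/2}$. A $1$-cocycle is a map $u:\Omega\to\mathcal{L}_A$ such that $u_{a+b}(x)=u_a(x)+u_b(x+a)$ for a.e. $x\in A$, for all $a,b\in\Omega$,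 and $b\mapsto\int_{A\setminus(A+c)}u_b(x)\overline{\xi(x)}dx$ is Borel for all $\xi\in\mathcal{L}_A$, $c\in\Omega$. It is a coboundary if there is $f\in\mathcal{L}_A$ with, for every $a\in\Omega$, $u_a(x)=f(x+a)-f(x)$ for a.e. $x\in A$. $Z^1(\Omega,\mathcal{L}_A)$, $B^1(\Omega,\mathcal{L}_A)$ are the spaces of $1$-cocycles and coboundaries, and $H^1=Z^1/B^1$. Every $1$-cocycle on $\Omega$ extends uniquely to a continuous map $u:P\to\mathcal{L}_A$ satisfying the same cocycle identity on $P$. For $\gamma_1,\gamma_2\in L(H)$, $u^{\gamma_1,\gamma_2}$ is the $1$-cocycle with $u^{\gamma_1,\gamma_2}_a$ the constant function $\langle\gamma_1|a\rangle+i\langle\gamma_2|a\rangle$ on $A$. Let $V=V^A$ be the isometric representation of $P$ on $L^2(A)$ given by $V_af(x)=f(x-a)$ if $x-a\in A$ and $V_af(x)=0$ otherwise. For $u\in Z^1(\Omega,\mathcal{L}_A)$ (extended to $P$) put $\Gamma^u(a,b)=u_a1_{A\setminus(A+b)}\in\mathrm{Ker}(V_b^* )$, $a,b\in P$. The cocycle $u$ is admissible if there is a Borel map $\alpha:P\times P\to\mathbb{T}$ (unit circle) with $$e^{i\,\mathrm{Im}\langle\Gamma^u(a,b+c)|V_b\Gamma^u(b,c)\rangle}=\frac{\alpha(a,b)\alpha(a+b,c)}{\alpha(a,b+c)\alpha(b,c)}\qquad(a,b,c\in P).$$ $H^1_a(\Omega,\mathcal{L}_A)$ is the image in $H^1(\Omega,\mathcal{L}_A)$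 of the set of admissible $1$-cocycles. *)

(* Defs.v *)
From HB Require Import structures.
From mathcomp Require Import all_boot all_order all_algebra.
From mathcomp Require Import ring_quotient complex.
From mathcomp Require Import all_classical all_reals all_analysis.
Import Order.TTheory GRing.Theory Num.Theory.
Import numFieldNormedType.Exports.

Set Implicit Arguments.
Unset Strict Implicit.
Unset Printing Implicit Defensive.

Local Open Scope classical_set_scope.
Local Open Scope ring_scope.
Local Open Scope quotient_scope.
Local Open Scope complex_scope.

(* The group R^d / H with its quotient topology and its Borel sigma-algebra. *)
Definition coset_space (R : realType) (d : nat) (H : zmodClosed 'rV[R]_d)
  : Type := Quotient.quot H.

Section CosetSpaceInstances.
Variables (R : realType) (d : nat) (H : zmodClosed 'rV[R]_d).

HB.instance Definition _ :=
  PointedTopological.copy (coset_space H)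
    (quotient_topology (Quotient.quot H)).
HB.instance Definition _ :=
  generic_quotient.Quotient.copy (coset_space H) (Quotient.quot H).
HB.instance Definition _ := GRing.isZmodule.Build (coset_space H)
  (@Quotient.addqA _ H) (@Quotient.addqC _ H)
  (@Quotient.add0q _ H) (@Quotient.addNq _ H).
HB.instance Definition _ :=
  Measurable.copy (coset_space H)
    (g_sigma_algebraType (@open (coset_space H))).

End CosetSpaceInstances.

(* For a Borel set D, this is measurability of f on the subspace D. *)
Definition borel_fun (T U : topologicalType) (D : set T) (f : T -> U) :=
  forall Y : set U, <<s open >> Y -> <<s open >> (D `&` f @^-1` Y).

Section Euclidean.
Variables (R : realType) (d : nat).
Implicit Types (P : set 'rV[R]_d) (x y g : 'rV[R]_d).

Definition dot x y : R := \sum_i x ord0 i * y ord0 i.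

Definition spanning_pointed_closed_cone P :=
  [/\ closed P,
      @convex_set R 'rV[R]_d P,
      (forall (t : R) x, 0 <= t -> P x -> P (t *: x)),
      [set x - y | x in P & y in P] = setT
    & P `&` [set - x | x in P] = [set 0]].

Definition lspan (S : set 'rV[R]_d) : set 'rV[R]_d :=
  [set x | exists (n : nat) (c : 'I_n -> R) (s : 'I_n -> 'rV[R]_d),
      (forall i, S (s i)) /\ x = \sum_i c i *: s i].

Definition has_codim (S : set 'rV[R]_d) (k : nat) :=
  exists U : {vspace 'rV[R]_d},
    [set` U] = lspan S /\ (\dim U + k = \dim {: 'rV[R]_d})%N.

End Euclidean.

Section CosetSpace.
Variables (R : realType) (d : nat) (H : zmodClosed 'rV[R]_d).
Local Notation E := 'rV[R]_d.
Local Notation Q := (coset_space H).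
Local Notation "x +! a" := (x + \pi_Q a) (at level 50, left associativity).

(* On the second countable locally compact group R^d / H (H closed) the usual
   regularity requirements follow from finiteness on compact sets. *)
Definition haar_measure (mu : {measure set Q -> \bar R}) :=
  [/\ mu setT != 0%E,
      (forall K : set Q, compact K -> (mu K < +oo)%E)
    & forall (q : Q) (B : set Q), measurable B ->
        mu [set x + q | x in B] = mu B].

Definition closed_omega_space (Omega : set E) (A : set Q) :=
  [/\ closed A, A !=set0, A != setT
    & [set x +! a | x in A & a in Omega] `<=` A].

Definition cintegral (mu : {measure set Q -> \bar R}) (D : set Q)
    (f : Q -> R[i]) : R[i] :=
  (\int[mu]_(x in D) complex.Re (f x)) +i* (\int[mu]_(x in D) complex.Im (f x)).

Section Cocycles.
Variables (P : set E) (mu : {measure set Q -> \bar R}) (A : set Q).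
Local Notation Omega := (interior P).
Implicit Types (a b c : E) (f g : Q -> R[i]) (u v : E -> Q -> R[i]).

Definition slab b : set Q := A `\` [set x +! b | x in A].

Definition sq_integral b f : \bar R :=
  (\int[mu]_(x in slab b) ((Normc.normc (f x)) ^+ 2)%:E)%E.

(* Elements of the spaces below are represented by everywhere defined functions:
   values outside A, and u_a for a outside the semigroup, are irrelevant, and
   equality is always a.e. equality on A. *)
Definition LA f :=
  @borel_fun Q (R[i]^o) A f /\
  forall b, Omega b -> (sq_integral b f < +oo)%E.

(* `fine` loses nothing on elements of LA. *)
Definition LA_seminorm b f : R := Num.sqrt (fine (sq_integral b f)).

Definition cocycle_on (S : set E) u :=
  (forall a, S a -> LA (u a)) /\
  forall a b, S a -> S b ->
    {ae mu, forall x, A x -> u (a + b) x = u a x + u b (x +! a)}.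

Definition cocycle u :=
  cocycle_on Omega u /\
  forall xi c, LA xi -> Omega c ->
    @borel_fun E (R[i]^o) Omega
      (fun b => cintegral mu (slab c) (fun x => u b x * (xi x)^*)).

Definition coboundary u :=
  exists2 f, LA f &
    forall a, Omega a -> {ae mu, forall x, A x -> u a x = f (x +! a) - f x}.

(* The element u + B^1 of H^1 = Z^1 / B^1, for u in Z^1. *)
Definition H1_class u : set (E -> Q -> R[i]) :=
  [set v | cocycle v /\ coboundary (fun a x => v a x - u a x)].

(* v is the continuous extension of u to P; L_A carries the topology of its
   seminorms. *)
Definition cocycle_extension u v :=
  [/\ cocycle_on P v,
      (forall a b, P a -> Omega b ->
         LA_seminorm b (fun x => v a' x - v a x)
           @[a' --> within P (nbhs a)] --> (0 : R))
    & forall a, Omega a -> {ae mu, forall x, A x -> v a x = u a x}].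

Definition shift_isometry a f : Q -> R[i] :=
  fun x => if x +! (- a) \in A then f (x +! (- a)) else 0.

Definition inner f g : R[i] := cintegral mu A (fun x => f x * (g x)^*).

(* The first argument is a cocycle already extended to P. *)
Definition Gamma v a b : Q -> R[i] :=
  fun x => if x \in slab b then v a x else 0.

Definition expi (t : R) : R[i] := cos t +i* sin t.

Definition admissible u :=
  cocycle u /\
  exists v, cocycle_extension u v /\
  exists alpha : E -> E -> R[i],
    [/\ @borel_fun (E * E)%type (R[i]^o) (P `*` P) (fun p => alpha p.1 p.2),
        (forall a b, P a -> P b -> Normc.normc (alpha a b) = 1)
      & forall a b c, P a -> P b -> P c ->
          expi (complex.Im (inner (Gamma v a (b + c)) (shift_isometry b (Gamma v b c)))) =
          (alpha a b * alpha (a + b) c) / (alpha a (b + c) * alpha b c)].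

Definition H1_admissible : set (set (E -> Q -> R[i])) :=
  [set H1_class u | u in admissible].

End Cocycles.

Definition const_cocycle (g1 g2 : E) : E -> Q -> R[i] :=
  fun a _ => dot g1 a +i* dot g2 a.

End CosetSpace.
Arguments const_cocycle {R d} H g1 g2.

(* Main.v *)
Require Import Defs.
From HB Require Import structures.
From mathcomp Require Import all_boot all_order all_algebra.
From mathcomp Require Import ring_quotient complex.
From mathcomp Require Import all_classical all_reals all_analysis.
From mathcomp Require Import measurable_realfun.
From mathcomp Require Import ring lra.
Import Order.TTheory GRing.Theory Num.Theory.
Import numFieldNormedType.Exports.
Local Open Scope classical_set_scope.
Local Open Scope ring_scope.

Set Implicit Arguments.
Unset Strict Implicit.
Unset Printing Implicit Defensive.

(** The span of [H] is a hyperplane with a normal vector [n], and [Omega] lies on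
    one side of it. Hence [A] is squeezed between two half-spaces of the quotient,
    the slabs [A \ (A + b)] have finite positive measure, which is additive in
    [b], and translation by a fixed interior point [a] of the cone has the slab
    of [a] as a fundamental domain in [A].

    Every cocycle is a constant cocycle plus a coboundary
    ([extension_decomposition]); it is enough to show this for a real cocycle [w]
    ([real_cocycle_decomposition]). For [h] in [H] the difference
    [w (b + h) - w b] is invariant under the translations by [Omega], so by
    ergodicity ([invariant_ae_constant]) it is a constant [c h]. The function [c]
    is additive and small near 0, so it is the restriction of a linear form
    ([small_additive_linear]). A coboundary makes [w a] vanish
    ([coboundary_along]). After subtracting this coboundary and the linear form,
    [w b] depends only on the class of [b] modulo [H] and the multiples of [a],
    and these classes have representatives in a compact subset of [Omega]. So all
    values [w b] lie in one ball of the [L^2] space of the slab of [a]. The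
    cocycle acts on that space by the affine isometries
    [p |-> w b + p (. + b)], which permute the values and so fix the Chebyshev
    center of the set of values ([l2_center]): up to sign, this center is a
    primitive.

    For admissibility, antisymmetrize the phase
    [Im <Gamma(b1, b2 + c) | V_b2 Gamma(b2, c)>] over the six orders of
    [b1, b2, c]. The right-hand side of the condition becomes 1, because the
    semigroup is commutative ([expi_alternating_phase]). On the left, the second
    difference for steps [h] of [b1] and [k] of [b2] in [H] only sees the
    constants [dot g1] and [dot g2], and it equals
    [2 (dot g2 h * dot g1 k - dot g1 h * dot g2 k)] times the measure of the slab
    of [c] ([alternating_phase_second_difference]). This measure can be divided by
    any integer by shrinking [c], so the bracket vanishes
    ([phase_obstruction]), and [g1] and [g2], which lie in the span of [H], are
    proportional. Conversely, for proportional [g1] and [g2] the phase of the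
    constant cocycle is 0, and [alpha = 1] works. *)

(** * Vectors, spans and small additive functions *)

Section DotProduct.
Variables (R : realType) (d : nat).
Implicit Types x y z : 'rV[R]_d.

Lemma dotDl x y z : dot (x + y) z = dot x z + dot y z.
Proof. by rewrite /dot -big_split/=; apply: eq_bigr => i _; rewrite mxE mulrDl. Qed.

Lemma dotZl t x y : dot (t *: x) y = t * dot x y.
Proof. by rewrite /dot mulr_sumr; apply: eq_bigr => i _; rewrite mxE mulrA. Qed.

Lemma dotC x y : dot x y = dot y x.
Proof. by apply: eq_bigr => i _; rewrite mulrC. Qed.

Lemma dotDr x y z : dot z (x + y) = dot z x + dot z y.
Proof. by rewrite dotC dotDl !(dotC z). Qed.

Lemma dotZr t x y : dot y (t *: x) = t * dot y x.
Proof. by rewrite dotC dotZl (dotC y). Qed.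

Lemma dotNr x y : dot y (- x) = - dot y x.
Proof. by rewrite -scaleN1r dotZr mulN1r. Qed.

Lemma dotNl x y : dot (- x) y = - dot x y.
Proof. by rewrite -scaleN1r dotZl mulN1r. Qed.

Lemma dotBr x y z : dot z (x - y) = dot z x - dot z y.
Proof. by rewrite dotDr dotNr. Qed.

Lemma dotBl x y z : dot (x - y) z = dot x z - dot y z.
Proof. by rewrite dotDl dotNl. Qed.

Lemma dot0r x : dot x 0 = 0.
Proof. by rewrite -(scale0r 0) dotZr mul0r. Qed.

Lemma dot_sumr x (k : nat) (F : 'I_k -> 'rV[R]_d) :
  dot x (\sum_i F i) = \sum_i dot x (F i).
Proof. exact: (big_morph (dot x) (fun y z => dotDr y z x) (dot0r x)). Qed.

Lemma dot_eq0 x : (dot x x == 0) = (x == 0).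
Proof.
apply/eqP/eqP => [|->]; last exact: dot0r.
move=> /eqP; rewrite /dot psumr_eq0 => [/allP xx|i _]; last exact: sqr_ge0.
apply/rowP => i; rewrite mxE.
by have /= := xx i (mem_index_enum i); rewrite mulf_eq0 orbb => /eqP.
Qed.

Lemma dot_bound x y : `|dot x y| <= d%:R * `|x| * `|y|.
Proof.
rewrite (le_trans (ler_norm_sum _ _ _))//.
have -> : d%:R * `|x| * `|y| = \sum_(i < d) `|x| * `|y|.
  by rewrite sumr_const card_ord -mulrA mulr_natl.
apply: ler_sum => i _; rewrite normrM.
have le_norm (z : 'rV[R]_d) : `|z ord0 i| <= `|z|.
  rewrite [leRHS]/Num.norm /= mx_normrE.
  exact: (le_bigmax _ (fun ij => `|z ij.1 ij.2|) (ord0, i)).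
by rewrite ler_pM.
Qed.

Lemma dot_continuous x : continuous (dot x).
Proof.
apply: (@continuous_big R^o _ +%R 0 xpredT (@add_continuous R^o) _ _
  (fun i y => x ord0 i * y ord0 i)) => i _ y.
by apply: (@continuousM R _ (fun=> x ord0 i) (fun y => y ord0 i));
  [exact: cst_continuous|exact: coord_continuous].
Qed.

End DotProduct.

(** A nonzero vector in the kernel of the matrix of a basis of the hyperplane. *)
Lemma codim1_normal (R : realType) (d : nat) (S : set 'rV[R]_d) :
  has_codim S 1 ->
  exists2 n : 'rV[R]_d, n != 0 & forall x, lspan S x <-> dot n x = 0.
Proof.
move=> [U [US dimU]].
have US' x : lspan S x <-> x \in U by rewrite -US.
pose B : 'M[R]_(\dim U, d) := \matrix_i (vbasis U)`_i.
have [n nB n0] : exists2 n : 'rV[R]_d, n *m B^T = 0 & n != 0.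
  have : kermx B^T != 0.
    rewrite -mxrank_eq0 mxrank_ker -lt0n subn_gt0.
    rewrite (leq_ltn_trans (rank_leq_col _))//.
    by move: dimU; rewrite dimvf dim_matrix mul1r addn1 => ->.
  move=> /rowV0Pn[n nB n0]; exists n => //.
  by apply/eqP; rewrite -sub_kermx.
have nU x : x \in U -> dot n x = 0.
  move=> /coord_vbasis ->; rewrite dot_sumr big1// => i _.
  rewrite dotZr; apply/eqP; rewrite mulf_eq0; apply/orP; right; apply/eqP.
  move/matrixP : nB => /(_ ord0 i); rewrite [RHS]mxE => <-.
  by rewrite mxE; apply: eq_bigr => j _; rewrite !mxE.
exists n => // x; rewrite US'; split => [|nx]; first exact: nU.
apply/negPn/negP => xU.
have UxT : (U + <[x]>)%VS = fullv.
  apply/eqP; rewrite eqEdim subvf/= -dimU addn1.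
  rewrite ltn_neqAle (dimvS (addvSl U <[x]>)) andbT.
  apply: contra xU => /eqP UE; have : (U + <[x]> <= U)%VS.
    by rewrite -(geq_leqif (dimv_leqif_sup (addvSl _ _))) UE.
  by rewrite subv_add -memvE => /andP[].
have : n \in (U + <[x]>)%VS by rewrite UxT memvf.
move=> /memv_addP[u uU [y /vlineP[t ->] nE]].
by move: n0; rewrite -dot_eq0 {2}nE dotDr dotZr nx mulr0 addr0 nU ?eqxx.
Qed.

Lemma sub_lspan (R : realType) (d : nat) (S : set 'rV[R]_d) : S `<=` lspan S.
Proof.
by move=> x Sx; exists 1%N, (fun=> 1), (fun=> x); split => //; rewrite big_ord1 scale1r.
Qed.

(** A subfamily of [S] spanning a space of maximal dimension: unlike the vectors
    of a basis of the span, its members lie in [S] itself. *)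
Lemma lspan_finite_family (R : realType) (d : nat) (S : set 'rV[R]_d) :
  exists (k : nat) (e : 'I_k -> 'rV[R]_d), (forall i, S (e i)) /\
    forall x, lspan S x -> exists t : 'I_k -> R, x = \sum_i t i *: e i.
Proof.
pose Pd m := `[< exists X : seq 'rV[R]_d, {in X, forall x, S x} /\
                  \dim <<X>> = m >].
have Pd0 : exists m, Pd m.
  by exists 0%N; apply/asboolP; exists [::]; rewrite span_nil dimv0.
have Pdb m : Pd m -> (m <= \dim {: 'rV[R]_d})%N.
  by move=> /asboolP[X [_ <-]]; exact/dimvS/subvf.
case: (ex_maxnP Pd0 Pdb) => m /asboolP[X [XS Xm]] mmax.
have SX x : S x -> x \in <<X>>%VS.
  move=> Sx; have /mmax : Pd (\dim <<x :: X>>).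
    apply/asboolP; exists (x :: X); split => // y.
    by rewrite inE => /orP[/eqP ->//|]; exact: XS.
  rewrite -Xm span_cons => dimle.
  have : (<[x]> + <<X>> <= <<X>>)%VS.
    by rewrite -(geq_leqif (dimv_leqif_sup (addvSr _ _))).
  by rewrite subv_add -memvE => /andP[].
exists (size X), (fun i => X`_i); split => [i|x [n [c [s [Ss ->]]]]].
  by apply: XS; exact: mem_nth.
have : \sum_i c i *: s i \in <<in_tuple X>>%VS.
  by apply: memv_suml => i _; apply: memvZ; exact: SX.
by move=> /coord_span ->; exists (fun i => coord (in_tuple X) i (\sum_i c i *: s i)).
Qed.

(** Dirichlet's theorem: two multiples of [t] have their fractional parts in the
    same box, by the pigeonhole principle. *)
Lemma simultaneous_dirichlet (R : realType) (k : nat) (t : 'I_k -> R) (e : R) :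
  0 < e -> exists (q : nat) (p : 'I_k -> int), (0 < q)%N /\
    forall i, `|q%:R * t i - (p i)%:~R| < e.
Proof.
move=> e0; pose N := (Num.truncn e^-1).
have N1e : N.+1%:R^-1 < e.
  rewrite -[ltRHS]invrK ltf_pV2 ?posrE ?invr_gt0 ?ltr0n//.
  exact: truncnS_gt.
pose fr (q : nat) i : R := q%:R * t i - (Num.floor (q%:R * t i))%:~R.
have fr0 q i : 0 <= fr q i by rewrite subr_ge0 ge_floor.
have fr1 q i : fr q i < 1.
  by rewrite ltrBlDl -[1]/(1%:~R) -intrD floorD1_gt.
pose f (q : 'I_(N.+1 ^ k).+1) : {ffun 'I_k -> 'I_N.+1} :=
  [ffun i => inord (Num.truncn (N.+1%:R * fr q i))].
have /injectivePn[q1 [q2 q12 fq12]] : ~~ injectiveb f.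
  apply/negP => /injectiveP /leq_card.
  by rewrite card_ffun !card_ord ltnn.
wlog lt12 : q1 q2 q12 fq12 / (q1 < q2)%N.
  move: (q12); rewrite -val_eqE neq_ltn => /orP[lt|lt] wl; first exact: wl lt.
  by apply: (wl q2 q1) => //; rewrite eq_sym.
exists (q2 - q1)%N, (fun i => Num.floor (q2%:R * t i) - Num.floor (q1%:R * t i)).
split; first by rewrite subn_gt0.
move=> i; apply: le_lt_trans N1e.
have -> : (q2 - q1)%:R * t i -
    (Num.floor (q2%:R * t i) - Num.floor (q1%:R * t i))%:~R =
    fr q2 i - fr q1 i.
  by rewrite /fr natrB ?(ltnW lt12)// intrB; ring.
have trN q : (Num.truncn (N.+1%:R * fr q i) < N.+1)%N.
  by rewrite truncn_lt_nat ?mulr_ge0// gtr_pMr ?ltr0n.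
move/ffunP : fq12 => /(_ i); rewrite !ffunE => /(congr1 val)/=.
rewrite !inordK ?trN// => trE.
have /andP[l1 u1] := @truncn_itv _ (N.+1%:R * fr q1 i) (mulr_ge0 (ler0n _ _) (fr0 _ _)).
have /andP[l2 u2] := @truncn_itv _ (N.+1%:R * fr q2 i) (mulr_ge0 (ler0n _ _) (fr0 _ _)).
rewrite trE in l1 u1.
have N0 : 0 < N.+1%:R :> R by rewrite ltr0n.
rewrite -(ler_pM2l N0) divff ?gt_eqF// -[X in X * _]gtr0_norm// -normrM.
rewrite -[(Num.truncn _).+1%:R]natr1 in u1 u2; rewrite ler_norml mulrBr; apply/andP; split; lra.
Qed.

(** For an additive function smallness near 0 is continuity. *)
Section SmallAdditive.
Variables (R : realType) (d : nat) (H : zmodClosed 'rV[R]_d).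
Variable c : 'rV[R]_d -> R.
Hypothesis cD : {in H &, {morph c : x y / x + y}}.
Hypothesis c_small : forall e : R, 0 < e ->
  exists2 del, 0 < del & forall h, h \in H -> `|h| < del -> `|c h| <= e.

Let c0 : c 0 = 0.
Proof. by apply: (addrI (c 0)); rewrite -cD ?rpred0// !addr0. Qed.

Let cN h : h \in H -> c (- h) = - c h.
Proof. by move=> hH; apply: (addrI (c h)); rewrite -cD ?rpredN// !subrr c0. Qed.

Let cMn h n : h \in H -> c (h *+ n) = c h *+ n.
Proof.
move=> hH; elim: n => [|n IH]; first by rewrite !mulr0n c0.
by rewrite !mulrS cD ?rpredMn// IH.
Qed.

Let cMz h (n : int) : h \in H -> c (h *~ n) = c h *~ n.
Proof.
move=> hH; case: n => n; first by rewrite -!pmulrn cMn.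
by rewrite !NegzE !mulrNz -!pmulrn cN ?rpredMn// cMn.
Qed.

Let c_sum k (F : 'I_k -> 'rV[R]_d) : (forall i, F i \in H) ->
  c (\sum_i F i) = \sum_i c (F i).
Proof.
elim: k F => [|k IH] F FH; first by rewrite !big_ord0 c0.
by rewrite !big_ord_recl cD ?IH ?rpred_sum.
Qed.

(** Approximating [t] by [p / q] turns the real relation into an integral one
    whose value in [H] is small, where [c] is small as well. *)
Lemma small_additive_relation k (t : 'I_k -> R) (h : 'I_k -> 'rV[R]_d) :
  (forall i, h i \in H) -> \sum_i t i *: h i = 0 -> \sum_i t i * c (h i) = 0.
Proof.
move=> hH th0; apply/eqP; rewrite -normr_eq0 eq_le normr_ge0 andbT.
apply/ler_addgt0Pr => e e0; rewrite add0r.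
have [del del0 cdel] := c_small (divr_gt0 e0 (ltr0n _ 2)).
pose M := 1 + \sum_i `|h i| + \sum_i `|c (h i)|.
have M1 : 1 <= M by rewrite /M -addrA lerDl addr_ge0// sumr_ge0.
have M0 : 0 < M by exact: lt_le_trans M1.
pose e' := Num.min (del / M) (e / 2 / M).
have e'0 : 0 < e' by rewrite lt_min !divr_gt0.
have [q [p [q0 qp]]] := simultaneous_dirichlet t e'0.
have q1 : 1 <= q%:R :> R by rewrite ler1n.
have hM : \sum_i `|h i| <= M by rewrite /M addrAC lerDr addr_ge0// sumr_ge0.
have cM : \sum_i `|c (h i)| <= M by rewrite /M lerDr addr_ge0// sumr_ge0.
have hM' : \sum_i `|h i| < M.
  by rewrite /M addrAC ltrDr ltr_pwDl// sumr_ge0.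
pose g := \sum_i h i *~ p i.
have gH : g \in H by rewrite rpred_sum// => i _; exact: rpredMz.
have gE : g = \sum_i ((p i)%:~R - q%:R * t i) *: h i.
  under eq_bigr => i _ do rewrite scalerBl scaler_int -scalerA.
  by rewrite sumrB -scaler_sumr th0 scaler0 subr0.
have g_small : `|g| < del.
  rewrite gE (le_lt_trans (ler_norm_sum _ _ _))//.
  apply: (@le_lt_trans _ _ (del / M * \sum_i `|h i|)).
    rewrite mulr_sumr; apply: ler_sum => i _; rewrite normrZ ler_wpM2r//.
    by rewrite distrC ltW// (lt_le_trans (qp i))// ge_min lexx.
  by rewrite mulrAC ltr_pdivrMr// ltr_pM2l.
have cg : c g = \sum_i (p i)%:~R * c (h i).
  rewrite /g c_sum => [|i]; last exact: rpredMz.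
  by apply: eq_bigr => i _; rewrite cMz// -mulrzl.
have cg' : c g = q%:R * (\sum_i t i * c (h i)) +
    \sum_i ((p i)%:~R - q%:R * t i) * c (h i).
  by rewrite cg mulr_sumr -big_split/=; apply: eq_bigr => i _; ring.
have : `|q%:R * (\sum_i t i * c (h i))| <= e.
  have -> : q%:R * (\sum_i t i * c (h i)) = c g -
      \sum_i ((p i)%:~R - q%:R * t i) * c (h i) by rewrite cg'; ring.
  rewrite (le_trans (ler_normB _ _))// [leRHS](splitr e) lerD//.
    exact: cdel.
  rewrite (le_trans (ler_norm_sum _ _ _))//.
  apply: (@le_trans _ _ (e / 2 / M * \sum_i `|c (h i)|)).
    rewrite mulr_sumr; apply: ler_sum => i _; rewrite normrM ler_wpM2r//.
    by rewrite distrC ltW// (lt_le_trans (qp i))// ge_min lexx orbT.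
  by rewrite mulrAC ler_pdivrMr// ler_wpM2l// divr_ge0// ltW.
by apply: le_trans; rewrite normrM ger0_norm// ler_peMl.
Qed.

(** As [c] respects the real linear relations in [H], its values on a spanning
    family from [H] extend to a linear form on the whole space. *)
Lemma small_additive_linear : exists g, forall h, h \in H -> c h = dot g h.
Proof.
have [k [e [eH espan]]] := lspan_finite_family ([set x | x \in H] : set 'rV[R]_d).
pose B : 'M[R]_(k, d) := \matrix_i e i.
pose C : 'rV[R]_k := \row_i c (e i).
have /submxP[g gE] : (C <= B^T)%MS.
  rewrite submxE; apply/eqP/rowP => j; rewrite [RHS]mxE mxE.
  under eq_bigr => i _ do rewrite mxE mulrC.
  apply: small_additive_relation => //.
  have /matrixP BK : B^T *m cokermx B^T = 0 by rewrite mulmx_coker.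
  apply/rowP => l; rewrite [RHS]mxE summxE.
  have {BK} BK : \sum_i B^T l i * cokermx B^T i j = 0.
    by move: (BK l j); rewrite !mxE.
  by rewrite -[RHS]BK; apply: eq_bigr => i _; rewrite !mxE mulrC.
exists g => h hH.
have ce i : c (e i) = dot g (e i).
  move/rowP : gE => /(_ i); rewrite mxE => ->; rewrite mxE.
  by apply: eq_bigr => j _; rewrite !mxE.
have [|t hE] := espan h; first exact: sub_lspan.
pose t' (i : 'I_k.+1) := if unlift ord0 i is Some j then - t j else 1.
pose h' (i : 'I_k.+1) := if unlift ord0 i is Some j then e j else h.
have h'H i : h' i \in H by rewrite /h'; case: unliftP => // j _; exact: eH.
have : \sum_i t' i *: h' i = 0.
  rewrite big_ord_recl /t' /h' unlift_none scale1r.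
  under eq_bigr => i _ do rewrite liftK scaleNr.
  by rewrite sumrN {1}hE subrr.
move=> /(small_additive_relation h'H).
rewrite big_ord_recl /t' /h' unlift_none mul1r.
under eq_bigr => i _ do rewrite liftK mulNr.
rewrite sumrN => /eqP; rewrite subr_eq0 => /eqP ->.
by rewrite hE dot_sumr; apply: eq_bigr => i _; rewrite ce dotZr.
Qed.

End SmallAdditive.

(** * The cone and its interior *)

Section Cone.
Variables (R : realType) (d : nat) (P : set 'rV[R]_d).
Hypothesis hP : spanning_pointed_closed_cone P.
Implicit Types (x y a b : 'rV[R]_d) (s t : R).
Local Notation Omega := (interior P).

Lemma coneZ t x : 0 <= t -> P x -> P (t *: x).
Proof. by case: hP => _ _ + _ _; exact. Qed.

Lemma coneD x y : P x -> P y -> P (x + y).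
Proof.
case: hP => _ cvx _ _ _ Px Py.
have half01 : (0 <= 2^-1 :> R) /\ (2^-1 <= 1 :> R) by split; lra.
pose l : {i01 R} := Itv01 half01.1 half01.2.
have : P (l%:num *: x + (1 - l%:num) *: y).
  by have /(_ l) := cvx x y; rewrite !inE; exact.
rewrite /l/= => /(coneZ (ler0n _ 2)).
rewrite scalerDr !scalerA divff ?pnatr_eq0// scale1r.
by have -> : 2 * (1 - 2^-1) = 1 :> R by [field]; rewrite scale1r.
Qed.

Lemma cone_sum k (F : 'I_k -> 'rV[R]_d) :
  P 0 -> (forall i, P (F i)) -> P (\sum_i F i).
Proof. by move=> P0 PF; apply: (big_ind P) => // x y; exact: coneD. Qed.

(** Doubling a difference decomposition of the standard basis gives a whole
    box inside the cone. *)
Lemma cone_interior_nonempty : Omega !=set0.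
Proof.
have hPP : [set x - y | x in P & y in P] = setT by case: hP.
have diff x : exists pq : 'rV[R]_d * 'rV[R]_d,
    [/\ P pq.1, P pq.2 & x = pq.1 - pq.2].
  have : [set x - y | x in P & y in P] x by rewrite hPP.
  by move=> [p Pp [q Pq <-]]; exists (p, q).
have P0 : P 0.
  by have [[p q] [/= Pp _ _]] := diff 0; rewrite -(scale0r p); exact: coneZ.
have [pq pqP] := @choice _ _ _ (fun i : 'I_d => diff (delta_mx 0 i)).
exists (\sum_i ((pq i).1 + (pq i).2)).
apply/nbhs_ballP; exists 1 => //= y.
rewrite -ball_normE/= => ys.
set s := \sum_i _ in ys *.
have -> : y = \sum_i ((1 + (y - s) 0 i) *: (pq i).1 +
                      (1 - (y - s) 0 i) *: (pq i).2).
  rewrite -[LHS](subrK s) {1}(row_sum_delta (y - s)) /s -big_split/=.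
  apply: eq_bigr => i _; have [_ _ ->] := pqP i.
  set t := (y - _) 0 i.
  rewrite !(scalerDl, scalerBl) !scale1r scalerBr.
  by rewrite scaleNr addrACA; congr (_ + _); rewrite addrC.
apply: cone_sum => // i; have [P1 P2 _] := pqP i.
have : `|(y - s) 0 i| < 1.
  apply: le_lt_trans ys; rewrite distrC [leRHS]/Num.norm /= mx_normrE.
  exact: (le_bigmax _ (fun ij => `|(y - s) ij.1 ij.2|) (0, i)).
by rewrite ltr_norml => /andP[? ?]; apply: coneD; apply: coneZ => //; lra.
Qed.

(** The multiples of an interior point swallow every bounded perturbation. *)
Lemma omega_absorb a : Omega a ->
  exists2 r, 0 < r & forall s x, 0 < s -> `|x| < s * r -> Omega (s *: a + x).
Proof.
move=> /nbhs_ballP[r /= r0 rP]; exists (r / 2) => [|s x s0 xs]; first exact: divr_gt0.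
apply/nbhs_ballP; exists (s * (r / 2)) => [|y]; first by rewrite /= mulr_gt0// divr_gt0.
rewrite -ball_normE/= => yx.
have -> : y = s *: (s^-1 *: y) by rewrite scalerA divff ?gt_eqF// scale1r.
apply: coneZ; first exact: ltW.
apply: rP; rewrite -ball_normE/=.
rewrite -(ltr_pM2l s0) -[X in X * `| _ |](gtr0_norm s0) -normrZ scalerBr scalerA.
rewrite divff ?gt_eqF// scale1r.
rewrite (_ : s *: a - y = (s *: a + x - y) - x); last by rewrite [RHS]addrAC addrK.
rewrite (le_lt_trans (ler_normB _ _))//.
by rewrite (_ : s * r = s * (r / 2) + s * (r / 2)); [exact: ltrD|field].
Qed.

Lemma omega_cone a : Omega a -> P a.
Proof. exact: interior_subset. Qed.

Lemma omegaZ s a : 0 < s -> Omega a -> Omega (s *: a).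
Proof.
move=> s0 /omega_absorb[r r0 /(_ s 0 s0)].
by rewrite normr0 addr0; apply; exact: mulr_gt0.
Qed.

Lemma omegaD a b : Omega a -> P b -> Omega (a + b).
Proof.
move=> /nbhs_ballP[r /= r0 rP] Pb; apply/nbhs_ballP; exists r => //= y.
rewrite -ball_normE/= => yab; rewrite -(subrK b y); apply: coneD => //.
by apply: rP; rewrite -ball_normE/= opprB addrA.
Qed.

Lemma omega_eventually a x : Omega a ->
  exists k0 : nat, forall k, (k0 <= k)%N -> Omega (k%:R *: a + x).
Proof.
move=> /omega_absorb[r r0 ra].
exists (Num.truncn (`|x| / r)).+1 => k kk.
have k0 : 0 < k%:R :> R by rewrite ltr0n; exact: leq_trans kk.
apply: ra => //; rewrite -ltr_pdivrMr//.
by rewrite (lt_le_trans (truncnS_gt _))// ler_nat.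
Qed.

End Cone.

(** * The quotient and the position of the space in it *)

Section Projection.
Variables (R : realType) (d : nat) (H : zmodClosed 'rV[R]_d).
Local Notation E := 'rV[R]_d.
Local Notation Q := (coset_space H).
Local Notation pi := (\pi_Q%qT).
Implicit Types (x y h : E) (p q : Q).

Lemma piD x y : pi (x + y) = pi x + pi y :> Q.
Proof. exact: (Quotient.pi_add H). Qed.

Lemma piN x : pi (- x) = - pi x :> Q.
Proof.
have pi0 : pi 0 = 0 :> Q by apply: (addrI (pi 0)); rewrite -piD !addr0.
by apply: (addIr (pi x)); rewrite -piD !addNr.
Qed.

Lemma piB x y : pi (x - y) = pi x - pi y :> Q.
Proof. by rewrite piD piN. Qed.

Lemma pi_eq x y : (pi x = pi y) <-> (x - y \in H).
Proof. by rewrite (Quotient.idealrBE H); split => [->|/eqP]. Qed.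

Lemma pi0 : pi 0 = 0 :> Q.
Proof. by rewrite -(subrr 0) piB subrr. Qed.

Lemma pi_sub h : h \in H -> pi h = 0 :> Q.
Proof. by move=> hH; rewrite -pi0; apply/pi_eq; rewrite subr0. Qed.

Lemma piDh x h : h \in H -> pi (x + h) = pi x.
Proof. by move=> hH; rewrite piD (pi_sub hH) addr0. Qed.

Lemma pi_repr q : pi (repr q) = q.
Proof. exact: reprK. Qed.

Lemma pi_surj q : exists x, q = pi x.
Proof. by exists (repr q); rewrite pi_repr. Qed.

Section Height.
Variable n : E.
Hypothesis nH : forall h, h \in H -> dot n h = 0.

(** The linear form [dot n] read on the quotient. *)
Definition height q : R := dot n (repr q).

Lemma height_pi x : height (pi x) = dot n x.
Proof.
apply/eqP; rewrite -subr_eq0 -dotBr nH//; apply/pi_eq; exact: pi_repr.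
Qed.

Lemma heightD p q : height (p + q) = height p + height q.
Proof.
have [x ->] := pi_surj p; have [y ->] := pi_surj q.
by rewrite -piD !height_pi dotDr.
Qed.

Lemma heightN q : height (- q) = - height q.
Proof. by have [x ->] := pi_surj q; rewrite -piN !height_pi dotNr. Qed.

Lemma heightB p q : height (p - q) = height p - height q.
Proof. by rewrite heightD heightN. Qed.

End Height.
End Projection.

(** Rounding the coefficients of a vector of the span. *)
Lemma lspan_near_lattice (R : realType) (d : nat) (H : zmodClosed 'rV[R]_d) :
  exists2 r : R, 0 < r &
    forall x, lspan [set x | x \in H] x -> exists2 h, h \in H & `|x - h| < r.
Proof.
have [k [e [eH espan]]] := lspan_finite_family ([set x | x \in H] : set 'rV[R]_d).
exists (1 + \sum_i `|e i|) => [|x /espan[t ->]].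
  by rewrite ltr_pwDl// sumr_ge0.
exists (\sum_i e i *~ Num.floor (t i)).
  by rewrite rpred_sum// => i _; rewrite rpredMz//; exact: eH.
rewrite -sumrB (le_lt_trans (ler_norm_sum _ _ _))//.
rewrite (@le_lt_trans _ _ (\sum_i `|e i|))// ?ltrDr//.
apply: ler_sum => i _; rewrite -scaler_int -scalerBl normrZ ler_piMl//.
rewrite ger0_norm ?subr_ge0 ?ge_floor// lerBlDl ltW//.
by rewrite -[1]/(1%:~R) -intrD floorD1_gt.
Qed.

Section Geometry.
Variables (R : realType) (d : nat) (P : set 'rV[R]_d).
Hypothesis hP : spanning_pointed_closed_cone P.
Variable H : zmodClosed 'rV[R]_d.
Variable A : set (coset_space H).
Hypothesis hA : closed_omega_space (interior P) A.
Local Notation Omega := (interior P).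
Local Notation pi := (\pi_(coset_space H)%qT).

Lemma omega_space_stable q b : A q -> Omega b -> A (q + pi b).
Proof. by move=> Aq Ob; case: hA => _ _ _; apply; exists q => //; exists b. Qed.

(** If [Omega] met the span of [H], it would contain elements of [H] deep
    inside, so [Omega + H] would be everything and so would [A]. *)
Lemma omega_avoids_lspan b : Omega b -> ~ lspan [set x | x \in H] b.
Proof.
move=> Ob bL; have [r r0 rH] := lspan_near_lattice H.
have [s s0 sb] := omega_absorb hP Ob.
have bLn m : lspan [set x | x \in H] (m%:R *: b).
  move: bL => [k [c [e [eH ->]]]]; exists k, (fun i => m%:R * c i), e; split => //.
  by rewrite scaler_sumr; apply: eq_bigr => i _; rewrite scalerA.
have all x : exists2 y, Omega y & pi x = pi y.
  pose m := (Num.truncn ((r + `|x|) / s)).+1.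
  have [h hH hr] := rH _ (bLn m).
  exists (m%:R *: b + (x - (m%:R *: b - h))).
    apply: sb; first by rewrite ltr0n.
    rewrite -ltr_pdivrMr// (le_lt_trans _ (truncnS_gt _))//.
    rewrite ler_pM2r ?invr_gt0// (le_trans (ler_normB _ _))//.
    by rewrite addrC lerD2r ltW.
    have -> : m%:R *: b + (x - (m%:R *: b - h)) = x + h.
    by rewrite opprB addrCA [h - _]addrC (addrA (_ *: b)) addrN add0r.
  by rewrite piDh.
have [_ [q0 Aq0] AT _] := hA; move/eqP: AT; apply.
apply/seteqP; split => // q _; have [x xE] := pi_surj (q - q0).
have [y Oy yE] := all x.
by have := omega_space_stable Aq0 Oy; rewrite -yE -xE addrCA subrr addr0.
Qed.

(** The convex set [Omega] misses the hyperplane, so it lies on one side. *)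
Lemma omega_space_normal : has_codim [set x | x \in H] 1 ->
  exists n a : 'rV[R]_d,
    [/\ Omega a, dot n a = 1, forall x, lspan [set x | x \in H] x <-> dot n x = 0
      & forall b, Omega b -> 0 < dot n b].
Proof.
move=> /codim1_normal[n0 _ n0L].
have [a Oa] := cone_interior_nonempty hP.
have n0Omega b : Omega b -> dot n0 b != 0.
  by move=> Ob; apply/eqP => /n0L; exact: omega_avoids_lspan.
pose n := (dot n0 a)^-1 *: n0.
have nE x : dot n x = (dot n0 a)^-1 * dot n0 x by rewrite dotZl.
have na : dot n a = 1 by rewrite nE mulVf// n0Omega.
have nL x : lspan [set x | x \in H] x <-> dot n x = 0.
  rewrite n0L nE; split => [->|/eqP]; first by rewrite mulr0.
  by rewrite mulf_eq0 invr_eq0 (negbTE (n0Omega _ Oa)) => /eqP.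
exists n, a; split => // b Ob; rewrite ltNge; apply/negP => nb.
pose c := - dot n b *: a + b.
have nb0 : dot n b < 0.
  rewrite lt_neqAle nb andbT; apply/eqP => /nL; exact: omega_avoids_lspan.
have : Omega c.
  by apply: (omegaD hP); [apply: (omegaZ hP) => //; rewrite oppr_gt0|exact: omega_cone].
move=> /omega_avoids_lspan; apply; apply/nL.
by rewrite dotDr dotZr na mulr1 addNr.
Qed.

Section Normalized.
Variables n a : 'rV[R]_d.
Hypotheses (Oa : Omega a) (na : dot n a = 1).
Hypothesis nL : forall x, lspan [set x | x \in H] x <-> dot n x = 0.

Lemma normal_sub h : h \in H -> dot n h = 0.
Proof.
by move=> hH; apply/nL; exact: sub_lspan.
Qed.

(** Modulo [H] the horizontal part of a vector can be kept bounded, and then a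
    large vertical part carries it into the cone. *)
Lemma omega_cosets : exists2 T : R, 0 < T &
  forall x, T < dot n x -> exists2 b, Omega b & pi b = pi x.
Proof.
have [r r0 rH] := lspan_near_lattice H.
have [s s0 sa] := omega_absorb hP Oa.
exists (r / s) => [|x Tx]; first exact: divr_gt0.
pose y := x - dot n x *: a.
have [|h hH yh] := rH y.
  by apply/nL; rewrite dotBr dotZr na mulr1 subrr.
exists (dot n x *: a + (y - h)).
  apply: sa; first by apply: lt_trans Tx; exact: divr_gt0.
  by apply: lt_trans yh _; rewrite -ltr_pdivrMr.
have -> : dot n x *: a + (y - h) = x - h.
  by rewrite /y addrA addrCA subrr addr0.
by rewrite piB (pi_sub hH) subr0.
Qed.

(** From a point of [A] one reaches everything that is higher by [T]; so [A]
    contains a half-space, and a missing point bounds [A] from below. *)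
Lemma omega_space_bounds : exists m M : R,
  (forall q, A q -> m <= height n q) /\ (forall q, M < height n q -> A q).
Proof.
have [T T0 TO] := omega_cosets; have nH := normal_sub.
have up q0 q : A q0 -> T < height n q - height n q0 -> A q.
  move=> Aq0; have [x xE] := pi_surj (q - q0).
  rewrite -(heightB nH) xE (height_pi nH) => /TO[b Ob bE].
  by have := omega_space_stable Aq0 Ob; rewrite bE -xE addrC subrK.
have [_ [q0 Aq0] AT _] := hA.
have [p Ap] : exists p, ~ A p.
  apply: contrapT => /forallNP Aall; move/eqP : AT; apply.
  by apply/seteqP; split => // q _; apply: contrapT; exact: Aall.
exists (height n p - T), (height n q0 + T); split => q.
  by move=> Aq; rewrite leNgt; apply/negP => qp; apply/Ap/(up q) => //; lra.
by move=> qM; apply: (up q0) => //; lra.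
Qed.

End Normalized.
End Geometry.

(** * Topology, Borel sets and Haar measure of the quotient *)

Lemma closed_borel (T : topologicalType) (C : set T) : closed C -> <<s open >> C.
Proof.
move=> cC; rewrite -(setCK C) -setTD; apply: sigma_algebraCD.
by apply: sub_gen_smallest; exact: closed_openC.
Qed.

Lemma rat_ball (R : realType) (t e : R) : 0 < e -> exists r : rat, `|ratr r - t| < e.
Proof.
move=> e0; have [|r] := @rat_in_itvoo R (t - e) (t + e); first lra.
by rewrite in_itv/= => /andP[? ?]; exists r; rewrite ltr_distl; apply/andP; split.
Qed.

Section CosetTopology.
Variables (R : realType) (d : nat) (H : zmodClosed 'rV[R]_d).
Local Notation E := 'rV[R]_d.
Local Notation Q := (coset_space H).
Local Notation pi := (\pi_Q%qT).
Implicit Types (x y h : E) (p q : Q).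

Lemma open_coset (U : set Q) : open U <-> open (pi @^-1` U).
Proof. by []. Qed.

Lemma coset_continuous_pi : continuous (pi : E -> Q).
Proof. by apply/continuousP. Qed.

Lemma coset_continuousP (Z : topologicalType) (f : Q -> Z) :
  continuous (f \o pi) -> continuous f.
Proof.
by move=> /continuousP cf; apply/continuousP => U /cf; rewrite comp_preimage.
Qed.

Lemma addr_row_continuous y : continuous (fun x : E => x + y).
Proof. by move=> x; apply: (@continuousD _ _ _ id (fun=> y)) => //; exact: cst_continuous. Qed.

Lemma coset_open_pi (U : set E) : open U -> open (pi @` U).
Proof.
move=> oU; apply/open_coset.
have -> : pi @^-1` (pi @` U) = \bigcup_(h in [set h | h \in H]) ((fun x => x + h) @^-1` U).
  apply/seteqP; split => [x [y Uy /pi_eq yx]|x [h hH Uxh]].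
    by exists (y - x) => //=; rewrite addrC subrK.
  by exists (x + h) => //; exact: piDh.
apply: bigcup_open => h _; move: U oU; apply/continuousP.
exact: addr_row_continuous.
Qed.

Lemma translate_continuous q : continuous (fun p : Q => p + q).
Proof.
have [y ->] := pi_surj q; apply: coset_continuousP => x.
have -> : (fun p : Q => p + pi y) \o pi = pi \o (fun x => x + y).
  by apply/funext => z /=; rewrite piD.
apply: continuous_comp; last exact: coset_continuous_pi.
exact: addr_row_continuous.
Qed.

Lemma open_measurable_coset (U : set Q) : open U -> measurable U.
Proof. by move=> oU; exact: sub_gen_smallest. Qed.

Lemma closed_measurable_coset (U : set Q) : closed U -> measurable U.
Proof. exact: closed_borel. Qed.

Lemma translate_measurable q : measurable_fun setT (fun p : Q => p + q).
Proof.
apply: (measurability (@open Q)) => // _ [U oU <-]; rewrite setTI.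
apply: open_measurable_coset; move: U oU; apply/continuousP.
exact: translate_continuous.
Qed.

Lemma continuous_measurable_coset (f : Q -> R) :
  continuous f -> measurable_fun setT f.
Proof.
move=> cf; apply: (measurability _ (RGenOpens.measurableE R)).
move=> _ [_ [a [b ->]] <-]; rewrite setTI; apply: open_measurable_coset.
by move/continuousP : cf; apply; exact: interval_open.
Qed.

Definition coset_box (i : 'rV[rat]_d * nat) : set Q :=
  pi @` (ball (map_mx ratr i.1 : E) i.2.+1%:R^-1).

Lemma coset_box_open i : open (coset_box i).
Proof. by apply: coset_open_pi; exact: ball_open. Qed.

Lemma rat_row_dense x (e : R) : 0 < e -> exists r : 'rV[rat]_d, `|map_mx ratr r - x| < e.
Proof.
move=> e0; have [r rP] := choice (fun i => rat_ball (x 0 i) e0).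
exists (\row_i r i); rewrite [ltLHS]/Num.norm /= mx_normrE.
by apply: bigmax_lt => // -[i j] _ /=; rewrite ord1 !mxE.
Qed.

(** The quotient inherits a countable basis from the rational balls. *)
Lemma coset_box_basis (U : set Q) q : open U -> U q ->
  exists2 i, coset_box i q & coset_box i `<=` U.
Proof.
move=> /open_coset oU; have [x ->] := pi_surj q => Ux.
have [e /= e0 eU] : exists2 e : R, 0 < e & ball x e `<=` pi @^-1` U.
  by move: oU; rewrite openE => /(_ _ Ux) /nbhs_ballP[e]; exists e.
pose m := Num.truncn (2 / e).
have me : m.+1%:R^-1 < e / 2.
  by rewrite -[ltRHS]invf_div ltf_pV2 ?posrE ?divr_gt0//; exact: truncnS_gt.
have [r rx] := @rat_row_dense x m.+1%:R^-1 ltac:(by rewrite invr_gt0).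
exists (r, m); first by exists x => //; rewrite -ball_normE.
move=> _ [y ry <-]; apply: eU; move: ry; rewrite -!ball_normE/= => ry.
rewrite -(subrK (map_mx ratr r) x) -addrA (le_lt_trans (ler_normD _ _))//.
rewrite distrC in rx.
by rewrite (_ : e = e / 2 + e / 2); [rewrite ltrD// (lt_trans _ me)|rewrite -splitr].
Qed.

(** Pairs carry the product sigma-algebra, which a countable basis relates to the
    open sets of the product. *)
Lemma coset_add_measurable : measurable_fun setT (fun pq : Q * Q => pq.1 + pq.2).
Proof.
apply: (measurability (@open Q)) => // _ [U oU <-]; rewrite setTI.
pose good (ij : ('rV[rat]_d * nat) * ('rV[rat]_d * nat)) :=
  forall p q, coset_box ij.1 p -> coset_box ij.2 q -> U (p + q).
pose F (ij : ('rV[rat]_d * nat) * ('rV[rat]_d * nat)) : set (Q * Q) :=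
  if `[< good ij >] then coset_box ij.1 `*` coset_box ij.2 else set0.
have -> : (fun pq : Q * Q => pq.1 + pq.2) @^-1` U = \bigcup_ij F ij.
  apply/seteqP; split => [[p q] /= Upq|[p q] [ij _]]; last first.
    by rewrite /F; case: asboolP => // gij [/= ? ?]; exact: gij.
  have [x px] := pi_surj p; have [y qy] := pi_surj q.
  have [e /= e0 eU] : exists2 e : R, 0 < e & ball (x + y) e `<=` pi @^-1` U.
    have /open_coset := oU; rewrite openE => /(_ (x + y)).
    by rewrite /preimage/= piD -px -qy => /(_ Upq) /nbhs_ballP[e]; exists e.
  have e20 : 0 < e / 2 by rewrite divr_gt0.
  have [i ip iU] := @coset_box_basis _ p (coset_open_pi (ball_open x (e / 2)))
    ltac:(by rewrite px; exists x => //; exact: ballxx).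
  have [j jq jU] := @coset_box_basis _ q (coset_open_pi (ball_open y (e / 2)))
    ltac:(by rewrite qy; exists y => //; exact: ballxx).
  exists (i, j) => //; rewrite /F; case: asboolP => // -[] p' q' /= /iU[x' xx' <-] /jU[y' yy' <-].
  rewrite -piD; apply: (eU (x' + y')); move: xx' yy'; rewrite -!ball_normE/= => xx' yy'.
  rewrite opprD addrACA (le_lt_trans (ler_normD _ _))//.
  by rewrite (splitr e) ltrD.
apply: countable_bigcupT_measurable; first exact: countableP.
move=> ij; rewrite /F; case: asboolP => // _.
by apply: measurableX; apply: open_measurable_coset; exact: coset_box_open.
Qed.

Section Height.
Variable n : E.
Hypothesis nL : forall x, lspan [set x | x \in H] x <-> dot n x = 0.
Variable a : E.
Hypothesis na : dot n a = 1.
Let nH : forall h, h \in H -> dot n h = 0 := normal_sub nL.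

Lemma height_continuous : continuous (height n : Q -> R).
Proof.
apply: coset_continuousP; rewrite (_ : _ \o _ = dot n); first exact: dot_continuous.
by apply/funext => x /=; rewrite (height_pi nH).
Qed.

Lemma height_measurable : measurable_fun setT (height n : Q -> R).
Proof. by apply: continuous_measurable_coset; exact: height_continuous. Qed.

(** The span of [H] is compact modulo [H], so a band of bounded height is. *)
Lemma height_band_compact (s t : R) : compact [set q : Q | s <= height n q <= t].
Proof.
have [r r0 rH] := lspan_near_lattice H.
pose M := (`|s| + `|t|) * `|a| + r.
pose K : set E := [set x | `|x| <= M] `&` [set x | s <= dot n x <= t].
have cK : compact K.
  apply: bounded_closed_compact.
    exists M; split; first exact: num_real.
    by move=> u Mu x [xM _]; exact: le_trans xM (ltW Mu).
  apply: closedI.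
    apply: (@closed_comp _ _ (fun x : E => `|x|) [set u | u <= M]).
      by move=> x _; exact: norm_continuous.
    exact: closed_le.
  rewrite (_ : [set _ | _] = dot n @^-1` `[s, t]).
    apply: closed_comp => [x _|]; first exact: dot_continuous.
    exact: interval_closed.
  by apply/seteqP; split => x /=; rewrite in_itv.
have -> : [set q : Q | s <= height n q <= t] = pi @` K.
  apply/seteqP; split => [q|_ [x [_ xst] <-]] /=; last by rewrite (height_pi nH).
  have [x ->] := pi_surj q; rewrite (height_pi nH) => xst.
  have [|h hH yh] := rH (x - dot n x *: a).
    by apply/nL; rewrite dotBr dotZr na mulr1 subrr.
  exists (x - h); last by rewrite piB (pi_sub hH) subr0.
  split => /=; last by rewrite dotBr (nH hH) subr0.
  rewrite (_ : x - h = dot n x *: a + (x - dot n x *: a - h)); last first.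
    by rewrite !addrA [_ + x]addrC addrK.
  rewrite (le_trans (ler_normD _ _))// lerD//; last exact: ltW.
  rewrite normrZ ler_wpM2r// ler_norml.
  have := ler_norm s; have := ler_norm (- s); have := ler_norm t; have := ler_norm (- t).
  by move: xst => /andP[? ?]; rewrite !normrN => *; apply/andP; split; lra.
apply: continuous_compact => //; apply: continuous_subspaceT.
exact: coset_continuous_pi.
Qed.

End Height.
End CosetTopology.

Section Haar.
Variables (R : realType) (d : nat) (H : zmodClosed 'rV[R]_d).
Local Notation E := 'rV[R]_d.
Local Notation Q := (coset_space H).
Variable mu : {measure set Q -> \bar R}.
Hypothesis hmu : haar_measure mu.

Lemma haar_translate (q : Q) (B : set Q) : measurable B ->
  mu ((fun x => x + q) @^-1` B) = mu B.
Proof.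
case: hmu => _ _ inv mB; rewrite -(inv (- q) B mB); congr (mu _).
apply/seteqP; split => [x Bx|_ [x Bx <-]] /=; last by rewrite subrK.
by exists (x + q) => //; rewrite addrK.
Qed.

Lemma ge0_integral_translate (q : Q) (B : set Q) (f : Q -> \bar R) : measurable B ->
  measurable_fun B f -> (forall x, B x -> (0 <= f x)%E) ->
  (\int[mu]_(x in (fun x => x + q)%R @^-1` B) f (x + q)%R = \int[mu]_(x in B) f x)%E.
Proof.
move=> mB mf f0.
have := @ge0_integral_pushforward _ _ _ _ _ _ (translate_measurable q) mu B f mB mf.
move=> /= <-; last by move=> x; rewrite inE; exact: f0.
apply: eq_measure_integral => [|mq C mC _]; first exact: translate_measurable.
exact: haar_translate.
Qed.

Lemma ae_translate (q : Q) (Pr : Q -> Prop) :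
  {ae mu, forall x, Pr x} -> {ae mu, forall x, Pr (x + q)}.
Proof.
move=> [N [mN N0 PN]]; exists ((fun x => x + q) @^-1` N); split.
- rewrite -[_ @^-1` _]setTI; exact: translate_measurable.
- by rewrite haar_translate.
- by move=> x /= nP; exact: PN.
Qed.

End Haar.

(** * Slabs *)

(** By Tonelli, both iterated integrals of the indicator of [N] vanish. *)
Lemma null_sections (R : realType) (d1 d2 : measure_display)
    (T1 : measurableType d1) (T2 : measurableType d2)
    (m1 : {sigma_finite_measure set T1 -> \bar R})
    (m2 : {sigma_finite_measure set T2 -> \bar R}) (N : set (T1 * T2)) :
  measurable N -> (forall y, m1 [set x | N (x, y)] = 0%E) ->
  {ae m1, forall x, m2 [set y | N (x, y)] = 0%E}.
Proof.
move=> mN N0.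
have xsE x : xsection N x = [set y | N (x, y)].
  by apply/seteqP; split => y /=; rewrite /xsection/= inE.
have ysE y : ysection N y = [set x | N (x, y)].
  by apply/seteqP; split => x /=; rewrite /ysection/= inE.
have mF := @measurable_fun_xsection _ _ _ _ R m2 N mN.
have : (\int[m1]_x `|(m2 \o xsection N) x| = 0)%E.
  under eq_integral => x _ do rewrite gee0_abs//.
  transitivity (\int[m2]_y (m1 \o ysection N) y)%E.
    have := @indic_fubini_tonelli _ _ _ _ R m1 m2 N mN.
    by rewrite (indic_fubini_tonelli_FE m2 mN) (indic_fubini_tonelli_GE m1 mN).
  by apply: integral0_eq => y _ /=; rewrite ysE N0.
move=> /(ae_eq_integral_abs _ measurableT mF).
by apply: filterS => x /(_ I) /=; rewrite xsE.
Qed.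

Section OmegaSetting.
Variables (R : realType) (d : nat).
Local Notation E := 'rV[R]_d.

(** The standing data: [n] is the normal of the hyperplane spanned by [H],
    scaled to take the value 1 at a chosen interior point [a] of the cone, and
    [A] sits between two horizontal half-spaces of heights [m] and [M]. *)
Record omega_setting (P : set E) (H : zmodClosed E)
    (mu : {measure set (coset_space H) -> \bar R}) (A : set (coset_space H))
    (n a : E) (m M : R) : Prop := OmegaSetting {
  setting_cone : spanning_pointed_closed_cone P;
  setting_haar : haar_measure mu;
  setting_space : closed_omega_space (interior P) A;
  setting_interior : interior P a;
  setting_unit : dot n a = 1;
  setting_normal : forall x, lspan [set x | x \in H] x <-> dot n x = 0;
  setting_pos : forall b, interior P b -> 0 < dot n b;
  setting_lower : forall q, A q -> m <= height n q;
  setting_upper : forall q, M < height n q -> A q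
}.

Lemma omega_setting_exists (P : set E) (H : zmodClosed E)
    (mu : {measure set (coset_space H) -> \bar R}) (A : set (coset_space H)) :
  spanning_pointed_closed_cone P -> has_codim [set x | x \in H] 1 ->
  haar_measure mu -> closed_omega_space (interior P) A ->
  exists n a m M, omega_setting P mu A n a m M.
Proof.
move=> hP hc hmu hA.
have [n [a [Oa na nL npos]]] := omega_space_normal hP hA hc.
have [m [M [mA MA]]] := omega_space_bounds hP hA Oa na nL.
by exists n, a, m, M; split.
Qed.

Section Setting.
Variables (P : set E) (H : zmodClosed E).
Variables (mu : {measure set (coset_space H) -> \bar R}) (A : set (coset_space H)).
Variables (n a : E) (m M : R).
Hypothesis S : omega_setting P mu A n a m M.
Local Notation Q := (coset_space H).
Local Notation Omega := (interior P).
Local Notation pi := (\pi_(coset_space H)%qT).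
Implicit Types (b c : E) (x q : Q).

Let hP := setting_cone S.
Let hmu := setting_haar S.
Let Oa := setting_interior S.
Let na := setting_unit S.
Let nL := setting_normal S.
Let nH := normal_sub nL.

Lemma setting_stable x b : A x -> Omega b -> A (x + pi b).
Proof. exact: (omega_space_stable (setting_space S)). Qed.

Lemma measurable_space : measurable A.
Proof. by apply: closed_measurable_coset; case: (setting_space S). Qed.

Lemma slabP b x : slab A b x <-> A x /\ ~ A (x - pi b).
Proof.
rewrite /slab/=; split=> -[Ax nAx]; split => // Axb; apply: nAx.
  by exists (x - pi b) => //; rewrite subrK.
by case: Axb => y Ay <-; rewrite addrK.
Qed.

Lemma slab_sub b : slab A b `<=` A.
Proof. by move=> x /slabP[]. Qed.

Lemma measurable_translate_preimage q (B : set Q) : measurable B ->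
  measurable ((fun x : Q => x + q) @^-1` B).
Proof.
by move=> mB; rewrite -[_ @^-1` _]setTI; exact: translate_measurable.
Qed.

Lemma measurable_slab b : measurable (slab A b).
Proof.
rewrite (_ : slab A b = A `&` ~` ((fun x : Q => x - pi b) @^-1` A)).
  apply: measurableI; first exact: measurable_space.
  by apply: measurableC; apply: measurable_translate_preimage; exact: measurable_space.
by apply/seteqP; split => x; rewrite slabP.
Qed.

Lemma height_shift x b : height n (x + pi b) = height n x + dot n b.
Proof. by rewrite (heightD nH) (height_pi nH). Qed.

Lemma height_shiftB x b : height n (x - pi b) = height n x - dot n b.
Proof. by rewrite (heightB nH) (height_pi nH). Qed.

Lemma measurable_band (s t : R) : measurable [set x : Q | s <= height n x <= t].
Proof.
rewrite (_ : [set _ | _] = height n @^-1` `[s, t]).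
  by rewrite -[_ @^-1` _]setTI; apply: (height_measurable nL).
by apply/seteqP; split => x /=; rewrite in_itv.
Qed.

Lemma band_finite (s t : R) : (mu [set x : Q | (s <= height n x <= t)%R] < +oo)%E.
Proof.
by case: hmu => _ + _; apply; exact: (height_band_compact nL na).
Qed.

Lemma slab_band b x : slab A b x -> m <= height n x <= M + dot n b.
Proof.
move=> /slabP[Ax nAx]; rewrite (setting_lower S)//= leNgt; apply/negP => Mx.
by apply/nAx/(setting_upper S); rewrite height_shiftB ltrBrDr.
Qed.

Lemma slab_finite b : (mu (slab A b) < +oo)%E.
Proof.
apply: le_lt_trans (band_finite m (M + dot n b)).
apply: le_measure; rewrite ?inE; [exact: measurable_slab|exact: measurable_band|].
by move=> x; exact: slab_band.
Qed.

Lemma low_slab b x : A x -> height n x < m + dot n b -> slab A b x.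
Proof.
move=> Ax xb; apply/slabP; split => // /(setting_lower S).
by rewrite height_shiftB; lra.
Qed.

(** The slabs behave like intervals: [slab b] is followed by the translate of
    [slab c]. The measures of slabs and the integrals over them are compared
    through this decomposition. *)
Lemma slabD b c : Omega b -> Omega c ->
  slab A (b + c) = slab A b `|` (fun x => x - pi b) @^-1` (slab A c).
Proof.
move=> Ob Oc.
have shiftE x : x - pi (b + c) = x - pi b - pi c by rewrite piD opprD addrA.
apply/seteqP; split => x.
  move=> /slabP[Ax nAx]; have [Axb|nAxb] := pselect (A (x - pi b)).
    by right; apply/slabP; split => //; rewrite -shiftE.
  by left; apply/slabP.
move=> [/slabP[Ax nAx]|/slabP[Ax nAx]]; apply/slabP; rewrite shiftE; split => //.
- by move=> Axbc; apply: nAx; rewrite -(subrK (pi c) (x - pi b)); exact: setting_stable.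
- by rewrite -(subrK (pi b) x); exact: setting_stable.
Qed.

Lemma slab_disj b c :
  [disjoint slab A b & (fun x => x - pi b) @^-1` (slab A c)].
Proof.
by apply/disj_setPS => x [/slabP[_ nAx] /slabP[]].
Qed.

Lemma ge0_integral_slabD b c (f : Q -> \bar R) : Omega b -> Omega c ->
  measurable_fun setT f -> (forall x, (0 <= f x)%E) ->
  (\int[mu]_(x in slab A (b + c)) f x =
   \int[mu]_(x in slab A b) f x + \int[mu]_(x in slab A c) f (x + pi b)%R)%E.
Proof.
move=> Ob Oc mf f0; rewrite slabD// ge0_integral_setU//; first last.
- exact: slab_disj.
- exact: measurable_funTS.
- by apply: measurable_translate_preimage; exact: measurable_slab.
- exact: measurable_slab.
congr (_ + _)%E.
have := @ge0_integral_translate _ _ _ _ hmu (pi b)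
  ((fun x => x - pi b) @^-1` (slab A c)) f.
move=> <-//; last 2 first.
- by apply: measurable_translate_preimage; exact: measurable_slab.
- exact: measurable_funTS.
congr (integral _ _ _).
by apply/seteqP; split => x /=; rewrite addrK.
Qed.

Lemma mu_slabD b c : Omega b -> Omega c ->
  mu (slab A (b + c)) = (mu (slab A b) + mu (slab A c))%E.
Proof.
move=> Ob Oc; have := ge0_integral_slabD Ob Oc (measurable_cst 1%E) (fun=> lee01).
by rewrite !integral_cst ?mul1e//; exact: measurable_slab.
Qed.

Lemma omega_natS b k : Omega b -> Omega (k.+1%:R *: b).
Proof. by move=> Ob; apply: (omegaZ hP). Qed.

Lemma mu_slabMn b k : Omega b ->
  mu (slab A (k.+1%:R *: b)) = (k.+1%:R%:E * mu (slab A b))%E.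
Proof.
move=> Ob; elim: k => [|k IH]; first by rewrite scale1r mul1e.
rewrite -(natr1 k.+1) scalerDl scale1r mu_slabD// ?IH; last exact: omega_natS.
by rewrite EFinD ge0_muleDl ?lee_fin// mul1e.
Qed.

(** Going down from [x] along [b] leaves [A], which is bounded from below. *)
Lemma slab_exhausts b x : Omega b -> A x -> exists k, slab A (k.+1%:R *: b) x.
Proof.
move=> Ob Ax; have b0 := setting_pos S Ob.
exists (Num.truncn ((height n x - m) / dot n b)); apply: low_slab => //.
by rewrite dotZr -ltrBlDl -ltr_pdivrMr// truncnS_gt.
Qed.

(** Countably many translates of [A] cover the whole quotient. *)
Lemma mu_space_neq0 : mu A != 0%E.
Proof.
apply/eqP => A0; case: hmu => /eqP + _ _; apply.
pose F k : set Q := (fun x => x + pi (k.+1%:R *: a)) @^-1` A.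
have mF k : measurable (F k).
  by apply: measurable_translate_preimage; exact: measurable_space.
have F0 k : mu (F k) = 0%E by rewrite haar_translate//; exact: measurable_space.
have -> : [set: Q] = \bigcup_k F k.
  apply/seteqP; split => // x _; exists (Num.truncn (M - height n x)) => //.
  apply: (setting_upper S); rewrite height_shift dotZr na mulr1 -ltrBlDl.
  exact: truncnS_gt.
have : mu.-negligible (\bigcup_k F k).
  by apply: negligible_bigcup => k; exists (F k); split.
move=> /measure_negligible; apply.
exact: bigcupT_measurable.
Qed.

(** Countably many slabs exhaust [A]. *)
Lemma null_on_slabs b (N : set Q) : Omega b ->
  (forall k, mu.-negligible (N `&` slab A (k.+1%:R *: b))) ->
  mu.-negligible (N `&` A).
Proof.
move=> Ob N0; apply: negligibleS (negligible_bigcup N0) => x [Nx Ax].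
by have [k kx] := slab_exhausts Ob Ax; exists k.
Qed.

Lemma mu_slab_gt0 b : Omega b -> (0 < mu (slab A b))%E.
Proof.
move=> Ob; rewrite lt0e measure_ge0 andbT; apply/eqP => b0.
have : mu.-negligible (setT `&` A).
  apply: (null_on_slabs Ob) => k; exists (slab A (k.+1%:R *: b)); split.
  - exact: measurable_slab.
  - by rewrite mu_slabMn// b0 mule0.
  - by move=> x [].
rewrite setTI => /measure_negligible -/(_ measurable_space) A0.
by move: mu_space_neq0; rewrite A0 eqxx.
Qed.

Lemma haar_sigma_finite : sigma_finite setT mu.
Proof.
exists (fun k : nat => [set x : Q | - k%:R <= height n x <= k%:R]).
  apply/seteqP; split => // x _; exists (Num.truncn `|height n x|).+1 => //=.
  by rewrite -ler_norml ltW// truncnS_gt.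
by move=> k; split; [exact: measurable_band|exact: band_finite].
Qed.

(** Ergodicity of the translations by [Omega]. By Tonelli there is a point [x0]
    with [g (x0 + y) = g x0] for almost every [y] in the image of [Omega]; this
    image contains everything high enough, so [g] is constant high up, and
    invariance carries the constant down to all of [A]. *)
Lemma invariant_ae_constant (g : Q -> R) : measurable_fun setT g ->
  (forall b, Omega b -> {ae mu, forall x, A x -> g (x + pi b) = g x}) ->
  exists t : R, {ae mu, forall x, A x -> g x = t}.
Proof.
move=> mg ginv.
pose mu_sfinite := isSFinite.Build _ _ _ _ (sfinite_measure_sigma_finite haar_sigma_finite).
pose mu_sigma_finite := isSigmaFinite.Build _ _ _ _ haar_sigma_finite.
pose nu : {sigma_finite_measure set Q -> \bar R} :=
  HB.pack (Measure.sort mu) mu_sfinite mu_sigma_finite.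
pose O : set Q := pi @` Omega.
have mO : measurable O.
  by apply: open_measurable_coset; apply: coset_open_pi; exact: open_interior.
pose D (z : Q * Q) := g (z.1 + z.2) - g z.1.
have mD : measurable_fun setT D.
  apply: measurable_funB; apply: measurableT_comp => //.
  exact: coset_add_measurable.
pose N : set (Q * Q) := (A `*` O) `&` (D @^-1` [set~ 0]).
have mN : measurable N.
  apply: measurableI; first by apply: measurableX => //; exact: measurable_space.
  rewrite -[_ @^-1` _]setTI; apply: mD => //.
  by apply: measurableC; exact: measurable_set1.
have N0 y : nu [set x | N (x, y)] = 0%E.
  have mNy : measurable [set x | N (x, y)].
    have := @measurable_ysection _ _ _ _ N y mN.
    rewrite (_ : ysection N y = [set x | N (x, y)])//.
    by apply/seteqP; split => x /=; rewrite /ysection/= inE.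
  apply: measure_negligible => //.
  have [[b Ob by_]|nOy] := pselect (O y); last first.
    by exists set0; split => // x [[_ Oy]].
  apply: negligibleS (ginv b Ob) => x [[/= Ax _] Dx] gx; apply: Dx.
  by rewrite /D/= -by_ gx// subrr.
have /= Nx0 := null_sections nu mN N0.
have [x0 Ax0 x0P] : exists2 x0, A x0 & mu [set y | N (x0, y)] = 0%E.
  apply: contrapT => /forall2NP nx0; move/eqP : mu_space_neq0; apply.
  apply: measure_negligible; first exact: measurable_space.
  by apply: negligibleS Nx0 => x Ax /= xP; have [] := nx0 x.
have [T T0 TO] := omega_cosets hP Oa na nL.
have high : {ae mu, forall x, height n x0 + T < height n x -> g x = g x0}.
  have mNx : measurable [set y | N (x0, y)].
    have := @measurable_xsection _ _ _ _ N x0 mN.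
    rewrite (_ : xsection N x0 = [set y | N (x0, y)])//.
    by apply/seteqP; split => y /=; rewrite /xsection/= inE.
  have : {ae mu, forall y, ~ N (x0, y)}.
    by exists [set y | N (x0, y)]; split => // y /= /contrapT.
  move=> /(@ae_translate _ _ _ _ hmu (- x0)); apply: filterS => x Nx hx.
  apply: contrapT => gx; apply: Nx; split; last first.
    by move=> /eqP; rewrite /D/= (addrC x0) subrK subr_eq0 => /eqP.
  split => //=; have [y yE] := pi_surj (x - x0).
  have [|b Ob bE] := TO y; last by exists b => //; rewrite bE.
  by rewrite -(height_pi nH) -yE (heightB nH); lra.
exists (g x0); pose k := Num.truncn (height n x0 + T - m).
have Ok : Omega (k.+1%:R *: a) by exact: omega_natS.
move: (ginv _ Ok) (@ae_translate _ _ _ _ hmu (pi (k.+1%:R *: a)) _ high).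
apply: filterS2 => x gx hx Ax; rewrite -gx// hx// height_shift dotZr na mulr1.
have := setting_lower S Ax; have : height n x0 + T - m < k.+1%:R by exact: truncnS_gt.
lra.
Qed.

End Setting.
End OmegaSetting.

(** * Chebyshev centers in the space of square integrable functions *)

Section L2Center.
Variables (d : measure_display) (T : measurableType d) (R : realType).
Variables (mu : {measure set T -> \bar R}) (D : set T).
Hypotheses (mD : measurable D) (muD : (mu D < +oo)%E).
Implicit Types f g h : T -> R.

Definition sq_int f : \bar R := (\int[mu]_(x in D) (f x ^+ 2)%:E)%E.

Lemma measurable_sq f : measurable_fun setT f ->
  measurable_fun D (fun x => (f x ^+ 2)%:E).
Proof.
by move=> mf; apply/measurable_EFinP; apply: measurable_funTS; exact: measurable_funX.
Qed.

Lemma sq_int_ge0 f : (0 <= sq_int f)%E.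
Proof. by apply: integral_ge0 => x _; rewrite lee_fin sqr_ge0. Qed.

Lemma sq_int_parallelogram f g : measurable_fun setT f -> measurable_fun setT g ->
  (sq_int (f \- g)%R + 4%:E * sq_int (fun x => (f x + g x) / 2)%R =
   2%:E * sq_int f + 2%:E * sq_int g)%E.
Proof.
move=> mf mg.
have m1 : measurable_fun setT (f \- g) by exact: measurable_funB.
have m2 : measurable_fun setT (fun x => (f x + g x) / 2).
  by apply: measurable_funM => //; exact: measurable_funD.
have pos (k : R) (u : T -> R) : 0 <= k ->
    forall x, D x -> (0 <= k%:E * (u x ^+ 2)%:E)%E.
  by move=> k0 x _; rewrite mule_ge0// lee_fin// sqr_ge0.
have mk (k : R) (u : T -> R) : measurable_fun setT u ->
    measurable_fun D (fun x => k%:E * (u x ^+ 2)%:E)%E.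
  by move=> mu_; apply: emeasurable_funM => //; exact: measurable_sq.
rewrite /sq_int -!ge0_integralZl//; do ?by [exact: measurable_sq|
  move=> x _; rewrite lee_fin sqr_ge0|rewrite lee_fin].
rewrite -!ge0_integralD//; do ?by [exact: measurable_sq|exact: mk|
  move=> x _; rewrite lee_fin sqr_ge0|exact: pos].
apply: eq_integral => x _; rewrite -!EFinM -!EFinD; congr EFin => /=.
by field.
Qed.

(** As [|z| <= 2^k z^2 / 2 + 2^-k / 2], the geometric decay of the square
    integrals makes the sum of the [|f_ k.+1 - f_ k|] integrable, hence finite
    almost everywhere. *)
Lemma fast_cauchy_ae_cvg (f_ : nat -> T -> R) (K : R) :
  (forall k, measurable_fun setT (f_ k)) ->
  (forall k, sq_int (f_ k.+1 \- f_ k)%R <= (K / 4 ^+ k)%:E)%E ->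
  {ae mu, forall x, D x -> cvgn (fun k => f_ k x)}.
Proof.
move=> mf fK.
pose u k x := (`|f_ k.+1 x - f_ k x|)%:E : \bar R.
have mu_ k : measurable_fun D (u k).
  apply/measurable_EFinP; apply: measurable_funTS; apply: measurableT_comp => //.
  exact: measurable_funB.
have u0 k x : (0 <= u k x)%E by rewrite lee_fin.
have [V VE] : exists V : R, mu D = V%:E.
  by exists (fine (mu D)); rewrite fineK// ge0_fin_numE.
pose C := K + V.
have uC k : (\int[mu]_(x in D) u k x <= (C / (2 ^ (k + 1))%:R)%:E)%E.
  have t0 : (0 : R) < 2 ^+ k by rewrite exprn_gt0.
  pose v x : \bar R := ((2 ^+ k / 2)%:E * ((f_ k.+1 \- f_ k)%R x ^+ 2)%:E +
                        ((2 ^+ k)^-1 / 2)%:E)%E.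
  have mv : measurable_fun D (fun x => (2 ^+ k / 2)%:E * ((f_ k.+1 \- f_ k)%R x ^+ 2)%:E)%E.
    by apply: emeasurable_funM => //; apply: measurable_sq; exact: measurable_funB.
  apply: (@le_trans _ _ (\int[mu]_(x in D) v x)%E).
    apply: ge0_le_integral => //; first exact: emeasurable_funD.
    move=> x _; rewrite /u /v -EFinM -EFinD lee_fin /=.
    set z := f_ k.+1 x - f_ k x.
    rewrite -subr_ge0 -(@real_normK _ z) ?num_real//.
    have -> : 2 ^+ k / 2 * `|z| ^+ 2 + (2 ^+ k)^-1 / 2 - `|z| =
      (2 ^+ k * `|z| - 1) ^+ 2 / 2 ^+ k / 2 by field; rewrite gt_eqF.
    by rewrite !divr_ge0 ?sqr_ge0// ltW.
  rewrite ge0_integralD//; last first.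
    by move=> x _; rewrite mule_ge0// lee_fin ?sqr_ge0// divr_ge0// ltW.
  rewrite ge0_integralZl//; last 2 first.
  - by apply: measurable_sq; exact: measurable_funB.
  - by move=> x _; rewrite lee_fin sqr_ge0.
  rewrite integral_cst// VE.
  apply: (@le_trans _ _ ((2 ^+ k / 2)%:E * (K / 4 ^+ k)%:E +
                         ((2 ^+ k)^-1 / 2)%:E * V%:E)%E).
    apply: leeD2r; apply: lee_wpmul2l; first by rewrite lee_fin divr_ge0// ltW.
    exact: fK.
  rewrite -!EFinM -EFinD lee_fin /C natrX addn1 exprS.
  have -> : (4 : R) = 2 * 2 by rewrite -natrM.
  rewrite exprMn le_eqVlt; apply/orP; left; apply/eqP.
  by field; rewrite gt_eqF.
have sumfin : (\int[mu]_(x in D) (\sum_(k <oo) u k x) < +oo)%E.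
  rewrite integral_nneseries//.
  have geo := @cvg_geometric_eseries_half R C 0.
  apply: le_lt_trans (lee_nneseries _ (fun k _ => uC k)) _.
    by move=> k _ _; apply: integral_ge0.
  by rewrite (cvg_lim _ geo)// ltry.
have mS : measurable_fun D (fun x => \sum_(k <oo) u k x)%E.
  by apply: ge0_emeasurable_sum.
have : mu.-integrable D (fun x => \sum_(k <oo) u k x)%E.
  apply/integrableP; split => //.
  by under eq_integral => x _ do rewrite gee0_abs ?nneseries_ge0//.
move=> /(integrable_ae mD); apply: filterS => x fx Dx.
have {}fx := fx Dx.
have cvgs : cvgn (series (telescope (fun k => f_ k x)) : nat -> R^o).
  apply: normed_cvg; apply: nondecreasing_is_cvgn.
    by apply: nondecreasing_series => k _ _ /=.
  exists (fine (\sum_(k <oo) u k x)%E) => _ [k _ <-].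
  rewrite -lee_fin fineK// /series/= -sumEFin.
  by apply: nneseries_lim_ge => *; exact: u0.
have -> : (fun k => f_ k x) = (fun k => f_ 0%N x + series (telescope (fun k => f_ k x)) k).
  by apply/funext => k; rewrite -eq_sum_telescope.
by apply: is_cvgD => //; exact: is_cvg_cst.
Qed.

(** Closed balls are closed under limits almost everywhere, by Fatou's lemma. *)
Lemma fatou_sq_int (f_ : nat -> T -> R) f g (r : R) (e : nat -> R) :
  (forall k, measurable_fun setT (f_ k)) -> measurable_fun setT f ->
  measurable_fun setT g ->
  {ae mu, forall x, D x -> f_ ^~ x @ \oo --> f x} ->
  (forall k, sq_int (f_ k \- g)%R <= (r + e k)%:E)%E -> e @ \oo --> 0 ->
  (sq_int (f \- g)%R <= r%:E)%E.
Proof.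
move=> mf_ mf mg fae fr e0.
pose h k x : \bar R := ((f_ k \- g) x ^+ 2)%:E.
have mh k : measurable_fun D (h k).
  by apply: measurable_sq; exact: measurable_funB.
have h0 k x : D x -> (0 <= h k x)%E by rewrite lee_fin sqr_ge0.
have limE : {ae mu, forall x, D x -> limn_einf (h ^~ x) = ((f \- g) x ^+ 2)%:E}.
  move: fae; apply: filterS => x fx Dx; have {}fx := fx Dx.
  have : (fun k => h k x) @ \oo --> ((f \- g) x ^+ 2)%:E.
    apply: cvg_EFin; first exact: nearW.
    rewrite /h/=; apply: (@cvg_comp _ _ _ _ (fun y : R => y ^+ 2)); last first.
      exact: exprn_continuous.
    by apply: cvgB => //; exact: cvg_cst.
  by move=> /cvg_limn_einf_sup[].
have mlim : measurable_fun D (fun x => limn_einf (h ^~ x)).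
  rewrite (_ : (fun _ => _) = (fun x => - limn_esup (fun k => - h k x))%E)//.
  apply: measurableT_comp => //; apply: measurable_fun_limn_esup => k.
  exact: measurableT_comp.
have -> : sq_int (f \- g)%R = (\int[mu]_(x in D) limn_einf (h ^~ x))%E.
  apply: ae_eq_integral => //; first by apply: measurable_sq; exact: measurable_funB.
  by move: limE; apply: filterS => x hx Dx; rewrite hx.
apply: le_trans (fatou mu mD mh h0) _.
rewrite limn_einf_lim.
have cv : (fun k => (r + e k)%:E) @ \oo --> r%:E.
  apply: cvg_EFin; first exact: nearW.
  by rewrite -[X in _ --> X]addr0; apply: cvgD => //; exact: cvg_cst.
rewrite -(cvg_lim _ cv)//; apply: lee_lim; first exact: is_cvg_einfs.
  by apply/cvg_ex; exists r%:E.
apply: nearW => k; apply: le_trans (fr k).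
by apply: ereal_inf_lbound; exists k => //=.
Qed.

(** The Chebyshev center of a bounded family in [L^2]: the smallest ball with
    center in [F] that contains the family. The parallelogram identity makes
    minimizing sequences Cauchy and the minimizer unique. The closure
    conditions on [F] replace closedness in [L^2]; [limn_esup] is a measurable
    choice of limit. *)
Lemma l2_center (I : Type) (B : set I) (w : I -> T -> R) (F : set (T -> R)) (C : R) :
  (forall i, B i -> measurable_fun setT (w i)) -> B !=set0 ->
  (forall i, B i -> (sq_int (w i)%R <= C%:E)%E) ->
  (forall f, F f -> measurable_fun setT f) -> F (cst 0) ->
  (forall f g, F f -> F g -> F (fun x => (f x + g x) / 2)) ->
  (forall f_ : nat -> T -> R, (forall k, F (f_ k)) ->
    F (fun x => fine (limn_esup (fun k => (f_ k x)%:E)))) ->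
  exists r : R, exists2 p, F p & (forall i, B i -> (sq_int (p \- w i)%R <= r%:E)%E) /\
    forall q, F q -> (forall i, B i -> (sq_int (q \- w i)%R <= r%:E)%E) ->
      {ae mu, forall x, D x -> p x = q x}.
Proof.
move=> mw [i0 Bi0] wC mF F0 Fmid Flim.
pose good f (r : R) := F f /\ forall i, B i -> (sq_int (f \- w i)%R <= r%:E)%E.
pose G := [set r : R | exists f, good f r].
have G0 : lbound G 0.
  move=> r [f [_ /(_ _ Bi0) fr]]; rewrite -lee_fin; exact: le_trans (sq_int_ge0 _) fr.
have Gne : G !=set0.
  exists C, (cst 0); split => // i Bi; have := wC i Bi; congr (_ <= _)%E.
  by apply: eq_integral => x _ /=; rewrite sub0r sqrrN.
have Ginf : has_inf G by split => //; exists 0.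
pose r0 := inf G.
(* Two centers for radii close to the optimum are close to each other, since
   their midpoint cannot beat the optimum. *)
have key f g rf rg : good f rf -> good g rg ->
    (sq_int (f \- g)%R <= (2 * rf + 2 * rg - 4 * r0)%:E)%E.
  move=> [Ff fr] [Fg gr].
  have para i : B i -> (sq_int (f \- g)%R + 4%:E *
      sq_int ((fun x => (f x + g x) / 2) \- w i)%R <= (2 * rf + 2 * rg)%:E)%E.
    move=> Bi; have mwi := mw i Bi.
    have := @sq_int_parallelogram (f \- w i) (g \- w i)
      (measurable_funB (mF _ Ff) mwi) (measurable_funB (mF _ Fg) mwi).
    rewrite (_ : (f \- w i) \- (g \- w i) = f \- g); last first.
      by apply/funext => x /=; ring.
    rewrite (_ : (fun x => ((f \- w i) x + (g \- w i) x) / 2) =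
      (fun x => (f x + g x) / 2) \- w i); last first.
      by apply/funext => x /=; field.
    move=> ->; rewrite (_ : (2 * rf + 2 * rg)%:E = 2%:E * rf%:E + 2%:E * rg%:E)%E//.
    by rewrite leeD// lee_wpmul2l ?lee_fin//; [exact: fr|exact: gr].
  have fin : sq_int (f \- g)%R \is a fin_num.
    rewrite ge0_fin_numE ?sq_int_ge0//.
    apply: (@le_lt_trans _ _ (2 * rf + 2 * rg)%:E); last exact: ltry.
    by apply: le_trans (para _ Bi0); rewrite leeDl// mule_ge0// ?lee_fin// sq_int_ge0.
  rewrite -(fineK fin) lee_fin; set de := fine _.
  have : r0 <= (2 * rf + 2 * rg - de) / 4.
    apply: ge_inf; first by exists 0.
    exists (fun x => (f x + g x) / 2); split; first exact: Fmid.
    move=> i Bi; have := para i Bi; rewrite -(fineK fin) -/de.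
    rewrite -leeBrDl// -EFinB => le4.
    rewrite mulrC EFinM -(@lee_pmul2l _ 4%:E)// ?lte_fin// muleA -EFinM divff//.
    by rewrite mul1r.
  by rewrite ler_pdivlMr//; lra.
have /choice[f_ f_P] : forall k : nat, exists f, good f (r0 + (4 ^+ k)^-1).
  move=> k.
  have [|r [f [Ff fr]] rk] := @inf_adherent R G (4 ^+ k)^-1 _ Ginf.
    by rewrite invr_gt0 exprn_gt0.
  by exists f; split => // i Bi; apply: le_trans (fr i Bi) _; rewrite lee_fin ltW.
have mf_ k : measurable_fun setT (f_ k) by apply: mF; case: (f_P k).
have f_ae : {ae mu, forall x, D x -> cvgn (fun k => f_ k x)}.
  apply: (@fast_cauchy_ae_cvg _ 4 mf_) => k.
  apply: le_trans (key _ _ _ _ (f_P k.+1) (f_P k)) _; rewrite lee_fin exprS.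
  have : (0 : R) < 4 ^+ k by rewrite exprn_gt0.
  move: (4 ^+ k) => z z0; rewrite invfM.
  have : 0 < z^-1 by rewrite invr_gt0.
  by move: z^-1 => y y0; lra.
pose p x := fine (limn_esup (fun k => (f_ k x)%:E)).
have Fp : F p by apply: Flim => k; case: (f_P k).
have pae : {ae mu, forall x, D x -> f_ ^~ x @ \oo --> p x}.
  move: f_ae; apply: filterS => x fx Dx.
  have cx : f_ ^~ x @ \oo --> limn (f_ ^~ x) := fx Dx.
  have : (fun k => (f_ k x)%:E) @ \oo --> (limn (f_ ^~ x))%:E.
    by apply: cvg_EFin => //; exact: nearW.
  by rewrite /p => /cvg_limn_einf_sup[_ ->].
have pr i : B i -> (sq_int (p \- w i)%R <= r0%:E)%E.
  move=> Bi; apply: (@fatou_sq_int f_ _ _ _ (fun k => (4 ^+ k)^-1)) => //.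
  - exact: mF.
  - exact: mw.
  - by move=> k; case: (f_P k) => _; exact.
  - rewrite (_ : (fun _ => _) = geometric 1 (4^-1 : R)).
      by apply: cvg_geometric; rewrite ger0_norm ?invr_ge0// invf_lt1// ltr1n.
    by apply/funext => k; rewrite /geometric/= mul1r exprVn.
exists r0, p => //; split => // q Fq qr.
have := key p q r0 r0 (conj Fp pr) (conj Fq qr).
rewrite (_ : 2 * r0 + 2 * r0 - 4 * r0 = 0); last by ring.
move=> pq0.
have mpq : measurable_fun D (fun x => ((p \- q) x ^+ 2)%:E).
  by apply: measurable_sq; apply: measurable_funB; exact: mF.
have : (\int[mu]_(x in D) `|((p \- q) x ^+ 2)%:E| = 0)%E.
  under eq_integral => x _ do rewrite gee0_abs ?lee_fin ?sqr_ge0//.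
  by apply/eqP; rewrite eq_le pq0 sq_int_ge0.
move=> /(ae_eq_integral_abs _ mD mpq); apply: filterS => x px Dx.
have /= := px Dx; move=> [] /eqP; rewrite sqrf_eq0 subr_eq0 => /eqP.
done.
Qed.

End L2Center.

(** * Locally square integrable functions on the space *)

Section LocallySquareIntegrable.
Variables (R : realType) (d : nat) (P : set 'rV[R]_d) (H : zmodClosed 'rV[R]_d).
Variables (mu : {measure set (coset_space H) -> \bar R}) (A : set (coset_space H)).
Variables (n a : 'rV[R]_d) (m M : R).
Hypothesis S : omega_setting P mu A n a m M.
Local Notation E := 'rV[R]_d.
Local Notation Q := (coset_space H).
Local Notation Omega := (interior P).
Local Notation pi := (\pi_(coset_space H)%qT).
Implicit Types (b c h : E) (x q : Q) (f g : Q -> R).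

Let hP := setting_cone S.
Let hmu := setting_haar S.
Let Oa := setting_interior S.
Let na := setting_unit S.
Let nL := setting_normal S.
Let mslab b := measurable_slab S b.

Lemma omegaDD b c : Omega b -> Omega c -> Omega (b + c).
Proof. by move=> Ob Oc; apply: (omegaD hP) => //; exact: omega_cone. Qed.

Lemma measurable_shift f q : measurable_fun setT f ->
  measurable_fun setT (fun x => f (x + q)).
Proof.
by move=> mf; apply: (measurableT_comp mf); exact: translate_measurable.
Qed.

Lemma sq_int_ae b f g : measurable_fun setT f -> measurable_fun setT g ->
  {ae mu, forall x, A x -> f x = g x} ->
  sq_int mu (slab A b) f = sq_int mu (slab A b) g.
Proof.
move=> mf mg fg; apply: ae_eq_integral; rewrite ?mslab//; do ?exact: measurable_sq.
by move: fg; apply: filterS => x fg /slab_sub /fg ->.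
Qed.

Lemma sq_intD_le b f g : measurable_fun setT f -> measurable_fun setT g ->
  (sq_int mu (slab A b) (f \+ g)%R <=
   2%:E * sq_int mu (slab A b) f + 2%:E * sq_int mu (slab A b) g)%E.
Proof.
move=> mf mg.
have := @sq_int_parallelogram _ _ _ mu _ (mslab b) f (\- g)%R mf (measurable_funN mg).
have -> : sq_int mu (slab A b) (\- g)%R = sq_int mu (slab A b) g.
  by apply: eq_integral => x _ /=; rewrite sqrrN.
move=> <-; rewrite (_ : f \- \- g = f \+ g); last first.
  by apply/funext => x /=; rewrite opprK.
by rewrite leeDl// mule_ge0// ?lee_fin// sq_int_ge0.
Qed.

Lemma sq_intB_le b f g : measurable_fun setT f -> measurable_fun setT g ->
  (sq_int mu (slab A b) (f \- g)%R <=
   2%:E * sq_int mu (slab A b) f + 2%:E * sq_int mu (slab A b) g)%E.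
Proof.
move=> mf mg; have -> : sq_int mu (slab A b) g = sq_int mu (slab A b) (\- g)%R.
  by apply: eq_integral => x _ /=; rewrite sqrrN.
by apply: sq_intD_le => //; exact: measurable_funN.
Qed.

Definition locL2 f := measurable_fun setT f /\
  forall b, Omega b -> (sq_int mu (slab A b) f < +oo)%E.

Lemma locL2D f g : locL2 f -> locL2 g -> locL2 (f \+ g).
Proof.
move=> [mf f2] [mg g2]; split; first exact: measurable_funD.
move=> b Ob; apply: le_lt_trans (sq_intD_le b mf mg) _.
by rewrite lte_add_pinfty// lte_mul_pinfty// ?lee_fin// ?f2 ?g2.
Qed.

Lemma locL2N f : locL2 f -> locL2 (\- f).
Proof.
move=> [mf f2]; split; first exact: measurable_funN.
move=> b Ob; have := f2 b Ob; congr (_ < _)%E.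
by apply: eq_integral => x _ /=; rewrite sqrrN.
Qed.

Lemma locL2B f g : locL2 f -> locL2 g -> locL2 (f \- g).
Proof. by move=> lf lg; apply: locL2D => //; exact: locL2N. Qed.

Lemma locL2_bounded f : measurable_fun setT f ->
  (forall b, Omega b -> exists C : R, forall x, slab A b x -> `|f x| <= C) ->
  locL2 f.
Proof.
move=> mf fb; split => // b Ob; have [C fC] := fb b Ob.
apply: (@le_lt_trans _ _ (\int[mu]_(x in slab A b) (C ^+ 2)%:E)%E).
  apply: ge0_le_integral => //.
  - by move=> x _; rewrite lee_fin sqr_ge0.
  - exact: measurable_sq.
  - move=> x /fC fx; rewrite lee_fin -(real_normK (num_real (f x))).
    by rewrite lerXn2r// ?nnegrE// (le_trans (normr_ge0 (f x))).
rewrite integral_cst// lte_mul_pinfty// ?lee_fin ?sqr_ge0//.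
exact: (slab_finite S).
Qed.

Lemma locL2_cst (t : R) : locL2 (cst t).
Proof.
by apply: locL2_bounded => // b _; exists `|t|.
Qed.

Lemma locL2_height (t : R) : locL2 (fun x => t * height n x).
Proof.
apply: locL2_bounded => [|b Ob].
  by apply: measurable_funM => //; exact: height_measurable.
exists (`|t| * (`|m| + `|M + dot n b|)) => x /(slab_band S) /andP[xm xM].
rewrite normrM ler_wpM2l// ler_norml.
have := ler_norm m; have := ler_norm (- m).
have := ler_norm (M + dot n b); have := ler_norm (- (M + dot n b)).
by rewrite !normrN => *; apply/andP; split; lra.
Qed.

Lemma slabS b c : Omega b -> Omega c -> slab A b `<=` slab A (b + c).
Proof. by move=> Ob Oc; rewrite (slabD S)//; exact: subsetUl. Qed.

Lemma sq_int_slabS b c f : Omega b -> Omega c -> measurable_fun setT f ->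
  (sq_int mu (slab A b) f <= sq_int mu (slab A (b + c)) f)%E.
Proof.
move=> Ob Oc mf; apply: ge0_subset_integral => //; first exact: measurable_sq.
- by move=> x _; rewrite lee_fin sqr_ge0.
- exact: slabS.
Qed.

Lemma sq_int_shift_le b c f : Omega b -> Omega c -> measurable_fun setT f ->
  (sq_int mu (slab A b) (fun x => f (x + pi c))%R <= sq_int mu (slab A (c + b)) f)%E.
Proof.
move=> Ob Oc mf; rewrite {2}/sq_int (ge0_integral_slabD S)//.
- by rewrite leeDr// integral_ge0// => x _; rewrite lee_fin sqr_ge0.
- exact: measurable_sq.
- by move=> x; rewrite lee_fin sqr_ge0.
Qed.

Lemma locL2_shift f c : Omega c -> locL2 f -> locL2 (fun x => f (x + pi c)).
Proof.
move=> Oc [mf f2]; split; first exact: measurable_shift.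
move=> b Ob; apply: le_lt_trans (sq_int_shift_le Ob Oc mf) _.
by apply: f2; exact: omegaDD.
Qed.

Lemma ae_space_eq (s t : R) : {ae mu, forall x, A x -> s = t} -> s = t.
Proof.
move=> st; apply: contrapT => nst; move/eqP : (mu_space_neq0 S); apply.
apply: measure_negligible; first exact: measurable_space S.
by apply: negligibleS st => x Ax /= sx; exact/nst/sx.
Qed.

Lemma ae_and (P1 P2 : Q -> Prop) :
  {ae mu, forall x, P1 x} -> {ae mu, forall x, P2 x} ->
  {ae mu, forall x, P1 x /\ P2 x}.
Proof. by apply: filterS2. Qed.

Lemma ae_shift (Pr : Q -> Prop) c : Omega c ->
  {ae mu, forall x, A x -> Pr x} -> {ae mu, forall x, A x -> Pr (x + pi c)}.
Proof.
move=> Oc /(ae_translate hmu (pi c)); apply: filterS => x Px Ax.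
by apply: Px; exact: (setting_stable S Ax Oc).
Qed.

(** For a function with period [a], the slab of [a] is a fundamental domain. *)
Section Periodic.
Variable phi : Q -> \bar R.
Hypotheses (mphi : measurable_fun setT phi) (phi0 : forall x, (0 <= phi x)%E).
Hypothesis phi_per : {ae mu, forall x, A x -> phi (x + pi a) = phi x}.

Let per_int b : (\int[mu]_(x in slab A b) phi (x + pi a)%R =
                 \int[mu]_(x in slab A b) phi x)%E.
Proof.
apply: ae_eq_integral; rewrite ?mslab//.
- apply: measurable_funTS; apply: (measurableT_comp mphi).
  exact: translate_measurable.
- exact: measurable_funTS.
- by move: phi_per; apply: filterS => x px /slab_sub /px ->.
Qed.

Lemma periodic_integralMn k :
  (\int[mu]_(x in slab A (k.+1%:R *: a)) phi x =
   k.+1%:R%:E * \int[mu]_(x in slab A a) phi x)%E.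
Proof.
elim: k => [|k IH]; first by rewrite scale1r mul1e.
have Oka := omega_natS S k Oa.
rewrite -(natr1 k.+1) scalerDl scale1r addrC (ge0_integral_slabD S)// per_int IH.
by rewrite EFinD ge0_muleDl ?lee_fin// mul1e addeC.
Qed.

Lemma multiple_above b : exists k, Omega (k.+1%:R *: a - b).
Proof.
by have [k /(_ k.+1 (leqnSn k))] := omega_eventually hP (- b) Oa; exists k.
Qed.

Lemma periodic_integral_finite b : Omega b ->
  (\int[mu]_(x in slab A a) phi x < +oo)%E ->
  (\int[mu]_(x in slab A b) phi x < +oo)%E.
Proof.
move=> Ob fin; have [k kb] := multiple_above b.
apply: (@le_lt_trans _ _ (\int[mu]_(x in slab A (k.+1%:R *: a)) phi x)%E).
  apply: ge0_subset_integral => //; first exact: measurable_funTS.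
  rewrite (_ : k.+1%:R *: a = b + (k.+1%:R *: a - b)); first exact: slabS.
  by rewrite addrC subrK.
by rewrite periodic_integralMn lte_mul_pinfty.
Qed.

(** The translate of a fundamental domain is another one: cut the slab of
    [a + b] in the two possible orders. *)
Lemma periodic_integral_shift b : Omega b ->
  (\int[mu]_(x in slab A a) phi x < +oo)%E ->
  (\int[mu]_(x in slab A a) phi (x + pi b)%R = \int[mu]_(x in slab A a) phi x)%E.
Proof.
move=> Ob fin; have finb := periodic_integral_finite Ob fin.
have := ge0_integral_slabD S Oa Ob mphi phi0.
rewrite addrC (ge0_integral_slabD S Ob Oa mphi phi0) per_int.
have finb' : (\int[mu]_(x in slab A b) phi x)%E \is a fin_num.
  by rewrite ge0_fin_numE// integral_ge0.
by move=> /(congr1 (fun z => z - \int[mu]_(x in slab A b) phi x)%E); rewrite [in LHS]addeC !addeK.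
Qed.

End Periodic.

(** Propagation from the slab of [a] through its translates. *)
Lemma periodic_ae f g :
  {ae mu, forall x, A x -> f (x + pi a) = f x} ->
  {ae mu, forall x, A x -> g (x + pi a) = g x} ->
  {ae mu, forall x, slab A a x -> f x = g x} ->
  {ae mu, forall x, A x -> f x = g x}.
Proof.
move=> fa ga fg.
have step k : {ae mu, forall x, slab A (k.+1%:R *: a) x -> f x = g x}.
  elim: k => [|k IH]; first by rewrite scale1r.
  have Oka := omega_natS S k Oa.
  have IHa := ae_translate hmu (- pi a) IH.
  have faa := ae_translate hmu (- pi a) fa.
  have gaa := ae_translate hmu (- pi a) ga.
  have := ae_and (ae_and fg IHa) (ae_and faa gaa).
  apply: filterS => x [[fgx IHx] [fx gx]].
  rewrite -(natr1 k.+1) scalerDl scale1r addrC (slabD S)// => -[/fgx//|kx].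
  have Axa : A (x - pi a) := slab_sub kx.
  by rewrite -[in LHS](subrK (pi a) x) -[in RHS](subrK (pi a) x) fx// gx// IHx.
have /ae_foralln := step; apply: filterS => x xP Ax.
by have [k kx] := slab_exhausts S Oa Ax; exact: (xP k).
Qed.

End LocallySquareIntegrable.

(** * Real cocycles *)

Section RealCocycle.
Variables (R : realType) (d : nat) (P : set 'rV[R]_d) (H : zmodClosed 'rV[R]_d).
Variables (mu : {measure set (coset_space H) -> \bar R}) (A : set (coset_space H)).
Variables (n a : 'rV[R]_d) (m M : R).
Hypothesis S : omega_setting P mu A n a m M.
Local Notation E := 'rV[R]_d.
Local Notation Q := (coset_space H).
Local Notation Omega := (interior P).
Local Notation pi := (\pi_(coset_space H)%qT).
Local Notation locL2 := (locL2 P mu A).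
Implicit Types (b c h : E) (x q : Q) (f g : Q -> R) (w : E -> Q -> R).

Let hP := setting_cone S.
Let Oa := setting_interior S.
Let na := setting_unit S.
Let nL := setting_normal S.
Let nH := normal_sub nL.
Let mslab b := measurable_slab S b.

Definition real_cocycle w := (forall b, Omega b -> locL2 (w b)) /\
  forall b c, Omega b -> Omega c ->
    {ae mu, forall x, A x -> w (b + c) x = w b x + w c (x + pi b)}.

(** On [A + c] the backward translation is isometric, and elsewhere it gives 0. *)
Lemma locL2_backshift f c : Omega c -> (forall x, ~ A x -> f x = 0) ->
  locL2 f -> locL2 (fun x => f (x - pi c)).
Proof.
move=> Oc f0 [mf f2]; split; first exact: measurable_shift.
move=> b Ob; have mfc : measurable_fun setT (fun x => f (x - pi c)).
  exact: measurable_shift.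
have le1 := @sq_int_slabS _ _ _ _ _ _ _ _ _ _ S _ _ _ Ob Oc mfc.
apply: le_lt_trans le1 _; rewrite addrC /sq_int (ge0_integral_slabD S)//; last 2 first.
- by apply/measurable_EFinP; exact: measurable_funX.
- by move=> x; rewrite lee_fin sqr_ge0.
rewrite integral0_eq => [|x /slabP[_ nAx]]; last by rewrite f0// expr0n.
rewrite add0e; apply: le_lt_trans (f2 b Ob); rewrite le_eqVlt; apply/orP; left.
by apply/eqP; apply: eq_integral => x _; rewrite addrK.
Qed.

(** Along a single direction every function is a difference: prescribe 0 on the
    fundamental domain [slab A a] and propagate. *)
Lemma coboundary_along v : locL2 v ->
  exists2 f, locL2 f & forall x, A x -> f (x + pi a) - f x = v x.
Proof.
move=> lv; pose g x := \1_A x * v x.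
have mA : measurable A := measurable_space S.
have g0 x : ~ A x -> g x = 0.
  by move=> nAx; rewrite /g indicE memNset// mul0r.
have lg : locL2 g.
  split=> [|b Ob]; first by apply: measurable_funM; [exact: measurable_indic|case: lv].
  have := lv.2 b Ob; congr (_ < _)%E; apply: eq_integral => x.
  by rewrite inE => /slab_sub Ax; rewrite /g indicE mem_set// mul1r.
pose part K x := \sum_(j < K) g (x - pi (j.+1%:R *: a)).
have gK (K : nat) x : height n x - m < K.+1%:R -> g (x - pi (K.+1%:R *: a)) = 0.
  move=> xK; apply: g0 => /(setting_lower S).
  by rewrite (height_shiftB S) dotZr na mulr1; lra.
have part_ge (K L : nat) x : height n x - m < K%:R -> (K <= L)%N -> part L x = part K x.
  move=> xK /subnK <-; elim: (L - K)%N => [//|i IH].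
  rewrite addSn /part big_ord_recr/= -/(part _ x) IH gK ?addr0//.
  by apply: lt_le_trans xK _; rewrite ler_nat -addSn leq_addl.
(* Only finitely many terms are nonzero at each point, because going down
   leaves [A]. *)
pose f x := part (Num.truncn (height n x - m)).+1 x.
have fE (K : nat) x : height n x - m < K%:R -> f x = part K x.
  move=> xK; have xN := truncnS_gt (height n x - m).
  rewrite /f; set N := _.+1.
  by rewrite -(part_ge _ _ _ xN (leq_maxl N K)) -(part_ge _ _ _ xK (leq_maxr N K)).
have lpart K : locL2 (part K).
  elim: K => [|K IH].
    rewrite (_ : part 0 = cst 0); first exact: (locL2_cst S 0).
    by apply/funext => x; rewrite /part big_ord0.
  rewrite (_ : part K.+1 = part K \+ (fun x => g (x - pi (K.+1%:R *: a)))).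
    by apply: (locL2D S) => //; apply: locL2_backshift => //; exact: (omega_natS S).
  by apply/funext => x; rewrite /part big_ord_recr.
exists f.
  split.
    apply: (@measurable_fun_cvg _ _ _ setT part) => [K|x _]; first by case: (lpart K).
    apply: cvg_near_cst; exists (Num.truncn (height n x - m)).+1 => // K /= NK.
    by rewrite /f; apply: part_ge => //; exact: truncnS_gt.
  move=> b Ob; pose K := (Num.truncn (M + dot n b - m)).+1.
  have := (lpart K).2 b Ob; congr (_ < _)%E; apply: eq_integral => x.
  rewrite inE => /(slab_band S) /andP[_ xM]; rewrite (@fE K)//.
  by apply: le_lt_trans (truncnS_gt _); rewrite lerB.
move=> x Ax; pose K := (Num.truncn (height n x - m)).+1.
have xK : height n x - m < K%:R by exact: truncnS_gt.
rewrite (@fE K.+1); last by rewrite (height_shift S) na -natr1; lra.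
rewrite (@fE K x)// /part big_ord_recl/= scale1r addrK.
rewrite (_ : \sum_(i < K) _ = part K x).
  by rewrite addrK /g indicE mem_set// mul1r.
apply: eq_bigr => j _; congr g.
by rewrite /bump/= -[in LHS]natr1 scalerDl scale1r piD opprD addrACA addrN addr0.
Qed.

Lemma cocycle_correct w f : real_cocycle w -> locL2 f ->
  forall v : E, real_cocycle (fun b x => w b x - (f (x + pi b) - f x) - dot v b).
Proof.
move=> [w2 wc] lf v; split => [b Ob|b c Ob Oc].
  have -> : (fun x => w b x - (f (x + pi b) - f x) - dot v b) =
    (w b \- ((fun x => f (x + pi b)) \- f)) \- cst (dot v b) by [].
  apply: (locL2B S) => //; last exact: (locL2_cst S _).
  by apply: (locL2B S) => //; [exact: w2|apply: (locL2B S) => //; exact: (locL2_shift S)].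
have := wc b c Ob Oc; apply: filterS => x wx Ax.
by rewrite wx// dotDr piD addrA; ring.
Qed.

Lemma omega_eventually2 b c : exists2 e, Omega e & Omega (e + b) /\ Omega (e + c).
Proof.
have [k1 k1P] := omega_eventually hP b Oa.
have [k2 k2P] := omega_eventually hP c Oa.
exists ((maxn k1 k2).+1%:R *: a); first exact: (omega_natS S).
by split; [apply: k1P|apply: k2P]; rewrite leqW// ?leq_maxl ?leq_maxr.
Qed.

(** A cocycle changes by constants along [H]: the change does not depend on the
    base point of the semigroup, so it is an invariant function. *)
Lemma cocycle_lattice_constant w : real_cocycle w ->
  exists c : E -> R, forall h b, h \in H -> Omega b -> Omega (b + h) ->
    {ae mu, forall x, A x -> w (b + h) x - w b x = c h}.
Proof.
move=> [w2 wc].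
suff /choice[c cP] : forall h, exists t : R, h \in H -> forall b, Omega b ->
    Omega (b + h) -> {ae mu, forall x, A x -> w (b + h) x - w b x = t}.
  by exists c => h b hH Ob Obh; exact: cP.
move=> h; have [hH|] := boolP (h \in H); last by exists 0.
have base b c : Omega b -> Omega (b + h) -> Omega c ->
    {ae mu, forall x, A x -> w (c + b + h) x - w (c + b) x = w (b + h) x - w b x}.
  move=> Ob Obh Oc; have Och := wc _ _ Obh Oc; have Ocb := wc _ _ Ob Oc.
  move: (ae_and Och Ocb); apply: filterS => x [xh x0] Ax.
  have -> : c + b + h = b + h + c by rewrite [RHS]addrC addrA.
  by rewrite xh// (addrC c) x0// piDh//; ring.
have inv b : Omega b -> Omega (b + h) -> forall c, Omega c ->
    {ae mu, forall x, A x -> (w (b + h) (x + pi c) - w b (x + pi c)) =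
       w (b + h) x - w b x}.
  move=> Ob Obh c Oc; have Och := wc _ _ Oc Obh; have Ocb := wc _ _ Oc Ob.
  move: (ae_and (base b c Ob Obh Oc) (ae_and Och Ocb)).
  apply: filterS => x [xb [xh x0]] Ax.
  by rewrite -xb// -addrA xh// x0//; ring.
have [b0 Ob0 [Ob0h _]] := omega_eventually2 h h.
have [||t tP] := @invariant_ae_constant _ _ _ _ _ _ _ _ _ _ S
    (fun x => w (b0 + h) x - w b0 x).
- by apply: measurable_funB; [case: (w2 _ Ob0h)|case: (w2 _ Ob0)].
- exact: inv.
exists t => _ b Ob Obh.
have e1 := base b b0 Ob Obh Ob0; have e2 := base b0 b Ob0 Ob0h Ob.
move: (ae_and (ae_and e1 e2) tP); apply: filterS => x [[x1 x2] x3] Ax.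
by rewrite -x1// (addrC b0) x2// x3.
Qed.

Lemma lattice_constant_additive w (c : E -> R) : real_cocycle w ->
  (forall h b, h \in H -> Omega b -> Omega (b + h) ->
    {ae mu, forall x, A x -> w (b + h) x - w b x = c h}) ->
  {in H &, {morph c : h k / h + k}}.
Proof.
move=> wcy cP h k hH kH.
have [b Ob [Obh Obhk]] := omega_eventually2 h (h + k).
apply: (ae_space_eq S).
have kP : {ae mu, forall x, A x -> w (b + (h + k)) x - w (b + h) x = c k}.
  by have := cP k (b + h) kH Obh; rewrite addrA; apply; rewrite -addrA.
have hkP := cP (h + k) b (rpredD hH kH) Ob Obhk.
move: (ae_and (ae_and (cP h b hH Ob Obh) kP) hkP); apply: filterS.
by move=> x [[xh xk] xhk] Ax; rewrite -xhk// -xh// -xk//; ring.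
Qed.

Lemma sq_int_cst b (t : R) : sq_int mu (slab A b) (cst t) = ((t ^+ 2)%:E * mu (slab A b))%E.
Proof. by rewrite -(integral_cst mu (mslab b)). Qed.

(** Continuity for the seminorm of the single slab of [a]. *)
Definition slab_continuous w := forall b (e : R), Omega b -> 0 < e ->
  exists2 del : R, 0 < del & forall b', Omega b' -> `|b' - b| < del ->
    (sq_int mu (slab A a) (w b' \- w b)%R <= e%:E)%E.

(** [c h] is the difference of the nearby values [w (a + h)] and [w a]. *)
Lemma lattice_constant_small w (c : E -> R) : real_cocycle w -> slab_continuous w ->
  (forall h b, h \in H -> Omega b -> Omega (b + h) ->
    {ae mu, forall x, A x -> w (b + h) x - w b x = c h}) ->
  forall e : R, 0 < e ->
  exists2 del, 0 < del & forall h, h \in H -> `|h| < del -> `|c h| <= e.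
Proof.
move=> [w2 _] wcont cP e e0.
have V0 := mu_slab_gt0 S Oa; have Vfin := slab_finite S a.
have [V VE] : exists V : R, mu (slab A a) = V%:E.
  by exists (fine (mu (slab A a))); rewrite fineK// ge0_fin_numE// ltW.
rewrite VE lte_fin in V0.
have [del del0 delP] := wcont a (e ^+ 2 * V) Oa (mulr_gt0 (exprn_gt0 2 e0) V0).
have [r r0 ra] := omega_absorb hP Oa.
exists (Num.min del r) => [|h hH]; first by rewrite lt_min del0.
rewrite lt_min => /andP[hdel hr].
have Oah : Omega (a + h) by have := ra 1 h ltr01; rewrite mul1r scale1r; apply.
have := delP (a + h) Oah; rewrite addrAC subrr add0r => /(_ hdel).
rewrite (@sq_int_ae _ _ _ _ _ _ _ _ _ _ S _ _ (cst (c h))); last 3 first.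
- by apply: measurable_funB; [case: (w2 _ Oah)|case: (w2 _ Oa)].
- by [].
- exact: cP.
rewrite sq_int_cst VE -EFinM lee_fin ler_pM2r// => ce.
by move: ce; rewrite -(real_normK (num_real (c h))) ler_pXn2r ?nnegrE ?(ltW e0).
Qed.

(** Modulo [H] and the multiples of [a] the semigroup is compact: the height can
    be moved to the interval from [k] to [k + 1], and the horizontal part can be
    made shorter than [r]. The integer [k] is so large that such vectors lie in
    the cone. *)
Lemma omega_fundamental_compact : exists C : set E,
  [/\ compact C, C `<=` Omega,
      (exists2 e, Omega e & forall b, C b -> Omega (e - b)) &
      forall b, Omega b -> exists b' h (i j : nat), [/\ C b', h \in H &
        b + i%:R *: a = b' + j%:R *: a + h]].
Proof.
have [r r0 rH] := lspan_near_lattice H.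
have [s s0 sa] := omega_absorb hP Oa.
pose k := (Num.truncn (r / s)).+1.
have kr : r < k%:R * s by rewrite -ltr_pdivrMr// truncnS_gt.
pose C : set E := [set b | k%:R <= dot n b <= k%:R + 1] `&`
  [set b | `|b - dot n b *: a| <= r].
have bE b : dot n b *: a + (b - dot n b *: a) = b by rewrite addrC subrK.
have CO : C `<=` Omega.
  move=> b [/andP[kb _] br]; rewrite -[b]bE; apply: sa.
    by apply: lt_le_trans kb; rewrite ltr0n.
  by apply: le_lt_trans br _; apply: lt_le_trans kr _; rewrite ler_pM2r.
exists C; split => //.
- apply: bounded_closed_compact.
    exists ((k%:R + 1) * `|a| + r); split; first exact: num_real.
    move=> u Mu b [/andP[kb bk] br]; apply: le_trans (ltW Mu).
    rewrite -[b in leLHS]bE (le_trans (ler_normD _ _))// lerD// normrZ.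
    by rewrite ler_wpM2r// ger0_norm// (le_trans _ kb).
  have cn := @dot_continuous R d n.
  apply: closedI.
    rewrite (_ : [set _ | _] = dot n @^-1` `[k%:R, k%:R + 1]).
      by apply: closed_comp => [x _|]; [exact: cn|exact: interval_closed].
    by apply/seteqP; split => x /=; rewrite in_itv.
  apply: (@closed_comp _ _ (fun b : E => `|b - dot n b *: a|) [set u | u <= r]).
    move=> x _; apply: continuous_comp; last exact: norm_continuous.
    apply: (@continuousD R E E (@id E) (fun b : E => - (dot n b *: a)) x).
      exact: cvg_id.
    apply: (@continuousN R E E (fun b : E => dot n b *: a) x).
    by apply: (@continuousZr_tmp R E E); exact: cn.
  exact: closed_le.
- exists ((k + k).+2%:R *: a) => [|b [/andP[kb bk] br]].
    exact: (omega_natS S).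
  rewrite (_ : _ - b = ((k + k).+2%:R - dot n b) *: a + - (b - dot n b *: a)).
    have kk : k%:R <= (k + k).+2%:R - dot n b.
      by rewrite -!natr1 natrD; lra.
    apply: sa; first by apply: lt_le_trans kk; rewrite ltr0n.
    rewrite normrN; apply: le_lt_trans br _; apply: lt_le_trans kr _.
    by rewrite ler_pM2r.
  by apply/rowP => i; rewrite !mxE; ring.
- move=> b Ob; have b0 := setting_pos S Ob.
  have [|h hH yh] := rH (b - dot n b *: a).
    by apply/nL; rewrite dotBr dotZr na mulr1 subrr.
  pose j := Num.truncn (dot n b).
  have /andP[jb bj] := truncn_itv (ltW b0); rewrite -/j in jb bj.
  have b'n : dot n (b + k%:R *: a - j%:R *: a - h) = dot n b + k%:R - j%:R.
    by rewrite !dotBr dotDr !dotZr na !mulr1 (nH hH) subr0.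
  exists (b + k%:R *: a - j%:R *: a - h), h, k, j; split => //.
    split; rewrite /= b'n.
      by rewrite -natr1 in bj; apply/andP; split; lra.
    rewrite (_ : _ - _ *: a = b - dot n b *: a - h); first exact: ltW.
    by rewrite !scalerBl scalerDl; apply/rowP => i; rewrite !mxE; ring.
  by apply/rowP => i; rewrite !mxE; ring.
Qed.

Lemma slab_continuous_bounded w (C : set E) : real_cocycle w -> slab_continuous w ->
  compact C -> C `<=` Omega ->
  exists K : R, forall b, C b -> (sq_int mu (slab A a) (w b) <= K%:E)%E.
Proof.
move=> [w2 _] wcont /compact_near_coveringP cC CO.
have := cC nat \oo (fun k b => Omega b -> (sq_int mu (slab A a) (w b) <= k%:R%:E)%E).
case.
- move=> b Cb; have Ob := CO _ Cb.
  have [del del0 delP] := wcont b 1 Ob ltr01.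
  have [V VE] : exists V : R, sq_int mu (slab A a) (w b) = V%:E.
    exists (fine (sq_int mu (slab A a) (w b))).
    by rewrite fineK// ge0_fin_numE ?sq_int_ge0//; exact: (w2 b Ob).2.
  exists (ball b del, [set k : nat | 2 + 2 * V <= k%:R]).
    split => /=; first exact: nbhsx_ballx.
    exists (Num.truncn (2 + 2 * V)).+1 => // k /= kV.
    by apply: le_trans (ltW (truncnS_gt _)) _; rewrite ler_nat.
  move=> [b' k] /= [bb' kV] Ob'.
  have dd : `|b' - b| < del by move: bb'; rewrite -ball_normE/= distrC.
  have := @sq_intD_le _ _ _ _ _ _ _ _ _ _ S a (w b' \- w b) (w b).
  rewrite (_ : (w b' \- w b) \+ w b = w b'); last first.
    by apply/funext => x /=; rewrite subrK.
  move=> /(_ (measurable_funB (w2 b' Ob').1 (w2 b Ob).1) (w2 b Ob).1) /le_trans; apply.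
  apply: (@le_trans _ _ (2%:E * 1%:E + 2%:E * V%:E)%E).
    by rewrite VE leeD2r// lee_wpmul2l ?lee_fin//; exact: delP.
  by rewrite -!EFinM -EFinD lee_fin mulr1.
- move=> N _ /(_ N (leqnn N)) NP; exists N%:R => b Cb.
  exact: NP (CO _ Cb).
Qed.

(** After subtraction of a coboundary and a linear form, the values of the cocycle
    have period [a] and do not see [H] nor [a] in the semigroup variable, so they
    form a bounded set. Every affine isometry [p |-> w' b + p (. + b)] permutes
    them; it fixes the Chebyshev center, which is therefore a primitive up to sign. *)
Lemma real_cocycle_decomposition w : real_cocycle w -> slab_continuous w ->
  exists (g : E) f, [/\ dot n g = 0, locL2 f & forall b, Omega b ->
    {ae mu, forall x, A x -> w b x = dot g b + (f (x + pi b) - f x)}].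
Proof.
move=> wcy wcont; have [w2 wc] := wcy.
have [f0 lf0 f0a] := coboundary_along (w2 _ Oa).
have [c cP] := cocycle_lattice_constant wcy.
have [g0 g0P] := small_additive_linear (lattice_constant_additive wcy cP)
  (lattice_constant_small wcy wcont cP).
(* [g1] is still [c] on [H], and it vanishes at [a], so that [w' a = 0]. *)
pose g1 := g0 - dot g0 a *: n.
have g1a : dot g1 a = 0 by rewrite dotBl dotZl na mulr1 subrr.
have g1H h : h \in H -> dot g1 h = c h.
  by move=> hH; rewrite dotBl dotZl (nH hH) mulr0 subr0 g0P.
pose w' b x := w b x - (f0 (x + pi b) - f0 x) - dot g1 b.
have w'cy : real_cocycle w' by exact: cocycle_correct.
have [w'2 w'c] := w'cy.
have mw' b : Omega b -> measurable_fun setT (w' b) by move=> /w'2[].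
have w'a x : A x -> w' a x = 0 by move=> Ax; rewrite /w' g1a f0a// subrr subr0.
have w'Da b : Omega b -> {ae mu, forall x, A x -> w' (b + a) x = w' b x}.
  move=> Ob; have := w'c b a Ob Oa; apply: filterS => x wx Ax.
  by rewrite wx// w'a ?addr0//; exact: (setting_stable S).
have w'per b : Omega b -> {ae mu, forall x, A x -> w' b (x + pi a) = w' b x}.
  move=> Ob; move: (ae_and (w'c a b Oa Ob) (w'Da b Ob)).
  apply: filterS => x [x1 x2] Ax; by rewrite -x2// (addrC b) x1// w'a// add0r.
have OD b k : Omega b -> Omega (b + k%:R *: a).
  case: k => [|k] Ob; first by rewrite scale0r addr0.
  by apply: (omegaDD S) => //; exact: (omega_natS S).
have w'Dka k b : Omega b -> {ae mu, forall x, A x -> w' (b + k%:R *: a) x = w' b x}.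
  move=> Ob; elim: k => [|k IH]; first by apply: nearW => x _; rewrite scale0r addr0.
  have := ae_and (w'Da _ (OD b k Ob)) IH; apply: filterS => x [x1 x2] Ax.
  by rewrite -natr1 scalerDl scale1r addrA x1// x2.
have w'Dh h b : h \in H -> Omega b -> Omega (b + h) ->
    {ae mu, forall x, A x -> w' (b + h) x = w' b x}.
  move=> hH Ob Obh; have := cP h b hH Ob Obh; apply: filterS => x xh Ax.
  by rewrite /w' piDh// dotDr (g1H _ hH) -(xh Ax); ring.
(* The values of [w'] are those over the compact set [C], hence bounded. *)
have [C [cC CO [e Oe eC] Cfund]] := omega_fundamental_compact.
have [K KP] := slab_continuous_bounded wcy wcont cC CO.
have [K' K'P] : exists K' : R, forall b, Omega b ->
    (sq_int mu (slab A a) (w' b) <= K'%:E)%E.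
  have finE b f : Omega b -> locL2 f -> exists t : R, sq_int mu (slab A b) f = t%:E.
    move=> Ob lf; exists (fine (sq_int mu (slab A b) f)).
    by rewrite fineK// ge0_fin_numE ?sq_int_ge0//; exact: lf.2.
  have [F1 F1E] := finE (e + a) f0 (omegaDD S Oe Oa) lf0.
  have [F0 F0E] := finE a f0 Oa lf0.
  have [V VE] := finE a (cst 1) Oa (locL2_cst S 1).
  have [N NP] : exists N : R, forall b, C b -> `|dot g1 b| <= N.
    have /compact_bounded [N [_ /(_ (N + 1))]] := cC; rewrite ltrDl ltr01 => /(_ isT) NP.
    exists (d%:R * `|g1| * (N + 1)) => b Cb.
    apply: le_trans (dot_bound _ _) _; rewrite ler_wpM2l ?mulr_ge0//.
    exact: NP.
  exists (2 * (2 * K + 2 * (2 * F1 + 2 * F0)) + 2 * (N ^+ 2 * V)) => b Ob.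
  have [b' [h [i [j [Cb' hH bE]]]]] := Cfund b Ob.
  have Ob' := CO b' Cb'; have Ob'j := OD b' j Ob'.
  have Obi := OD b i Ob.
  rewrite (@sq_int_ae _ _ _ _ _ _ _ _ _ _ S a _ (w' b')); last 3 first.
  - exact: mw'.
  - exact: mw'.
  - rewrite bE in Obi.
    move: (ae_and (ae_and (w'Dka i b Ob) (w'Dka j b' Ob')) (w'Dh h _ hH Ob'j Obi)).
    by apply: filterS => x [[x1 x2] x3] Ax; rewrite -x1// bE x3// x2.
  have mf0 := lf0.1; have mf0b := measurable_shift (pi b') mf0.
  have mD : measurable_fun setT ((fun x => f0 (x + pi b')) \- f0) by exact: measurable_funB.
  have mwb := (w2 b' Ob').1.
  have two (x y : \bar R) (s t : R) : (x <= s%:E)%E -> (y <= t%:E)%E ->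
      (2%:E * x + 2%:E * y <= (2 * s + 2 * t)%:E)%E.
    move=> xs yt.
    have -> : ((2 * s + 2 * t)%:E = 2%:E * s%:E + 2%:E * t%:E)%E by [].
    by apply: leeD; apply: lee_wpmul2l; rewrite ?lee_fin.
  have -> : w' b' = (w b' \- ((fun x => f0 (x + pi b')) \- f0)) \- cst (dot g1 b') by [].
  apply: le_trans (sq_intB_le S a _ _) _ => //; first exact: measurable_funB.
  apply: (two); last first.
    rewrite sq_int_cst; move: VE; rewrite sq_int_cst expr1n mul1e => VE.
    rewrite VE -EFinM lee_fin ler_wpM2r//.
      by rewrite -lee_fin -VE.
    rewrite -(real_normK (num_real (dot g1 b'))) lerXn2r ?nnegrE//.
      exact: le_trans (NP _ Cb').
    exact: NP.
  apply: le_trans (sq_intB_le S a _ _) _ => //.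
  apply: (two); first exact: KP.
  apply: le_trans (sq_intB_le S a _ _) _ => //.
  apply: (two); last by rewrite F0E.
  apply: le_trans (sq_int_shift_le S Oa Ob' mf0) _; rewrite -F1E.
  rewrite (_ : e + a = b' + a + (e - b')); last first.
    by rewrite [b' + a]addrC addrACA subrr addr0 addrC.
  exact: (sq_int_slabS S (omegaDD S Ob' Oa) (eC _ Cb') mf0).
(* Periodic competitors are determined by their restriction to the slab. *)
pose F : set (Q -> R) := [set p | measurable_fun setT p /\
  {ae mu, forall x, A x -> p (x + pi a) = p x}].
have [r [p [mp pper] [pr puniq]]] : exists r : R, exists2 p, F p &
    (forall b, Omega b -> (sq_int mu (slab A a) (p \- w' b)%R <= r%:E)%E) /\
    forall q : Q -> R, F q -> (forall b, Omega b -> (sq_int mu (slab A a) (q \- w' b)%R <= r%:E)%E) ->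
      {ae mu, forall x, slab A a x -> p x = q x}.
  apply: (@l2_center _ _ _ mu _ (mslab a) (slab_finite S a) E Omega w' F K') => //.
  - by exists a.
  - by move=> f [].
  - by split=> //; exact: nearW.
  - move=> f f' [mf fp] [mf' fp']; split.
      by apply: measurable_funM => //; exact: measurable_funD.
    by move: (ae_and fp fp'); apply: filterS => x [x1 x2] Ax; rewrite x1// x2.
  - move=> f_ Ff_; split.
      apply: measurableT_comp => //; apply: measurable_fun_limn_esup => k.
      by apply/measurable_EFinP; case: (Ff_ k).
    have : {ae mu, forall x, forall k, A x -> f_ k (x + pi a) = f_ k x}.
      by apply: ae_foralln => k; case: (Ff_ k).
    apply: filterS => x xk Ax; congr (fine (limn_esup _)).
    by apply/funext => k; rewrite xk.
have pcob b : Omega b -> {ae mu, forall x, A x -> w' b x = p x - p (x + pi b)}.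
  (* [q] is as good a center as [p]: its distance to [w' b'] is that of [p] to
     [w' b''], where [b + b'' = b'] modulo the multiples of [a]. *)
  move=> Ob; pose q x := p (x + pi b) + w' b x.
  have mpb : measurable_fun setT (fun x => p (x + pi b)) by exact: measurable_shift.
  have Fq : F q.
    split; first by apply: measurable_funD => //; exact: mw'.
    move: (ae_and (ae_shift S Ob pper) (w'per b Ob)).
    by apply: filterS => x [x1 x2] Ax; rewrite /q addrAC x1// x2.
  have qr b' : Omega b' -> (sq_int mu (slab A a) (q \- w' b')%R <= r%:E)%E.
    move=> Ob'; have [k kP] := omega_eventually hP (b' - b) Oa.
    pose b'' := b' - b + k.+1%:R *: a.
    have Ob'' : Omega b'' by rewrite /b'' addrC; apply: kP.
    have b''E : b + b'' = b' + k.+1%:R *: a.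
      by rewrite /b'' addrA [b + _]addrC subrK.
    rewrite (@sq_int_ae _ _ _ _ _ _ _ _ _ _ S a _ (fun x => (p \- w' b'') (x + pi b))).
    - have mpw : measurable_fun setT (p \- w' b'').
        by apply: measurable_funB => //; exact: mw'.
      rewrite /sq_int (@periodic_integral_shift _ _ _ _ _ _ _ _ _ _ S
        (fun x => ((p \- w' b'') x ^+ 2)%:E))//.
      + exact: pr.
      + by apply/measurable_EFinP; exact: measurable_funX.
      + by move=> x; rewrite lee_fin sqr_ge0.
      + move: (ae_and pper (w'per _ Ob'')); apply: filterS => x [x1 x2] Ax.
        by rewrite /= x1// x2.
      + by apply: le_lt_trans (pr _ Ob'') _; exact: ltry.
    - by apply: measurable_funB; [case: Fq|exact: mw'].
    - by apply: measurable_shift; apply: measurable_funB => //; exact: mw'.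
    - move: (ae_and (w'Dka k.+1 b' Ob') (w'c b b'' Ob Ob'')).
      apply: filterS => x [x1 x2] Ax.
      by rewrite /= -x1// -b''E x2// /q; ring.
  have := periodic_ae S pper Fq.2 (puniq q Fq qr).
  by apply: filterS => x px Ax; rewrite [in RHS]px// /q; ring.
have lp : locL2 p.
  split => // b Ob.
  apply: (@periodic_integral_finite _ _ _ _ _ _ _ _ _ _ S
    (fun x => (p x ^+ 2)%:E)) => //.
  - by apply/measurable_EFinP; exact: measurable_funX.
  - by move=> x; rewrite lee_fin sqr_ge0.
  - by move: pper; apply: filterS => x px Ax; rewrite px.
  - have -> : p = (p \- w' a) \+ w' a by apply/funext => x /=; rewrite subrK.
    apply: le_lt_trans (sq_intD_le S a (measurable_funB mp (mw' _ Oa)) (mw' _ Oa)) _.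
    apply: lte_add_pinfty; rewrite lte_mul_pinfty ?lee_fin//.
      by apply: le_lt_trans (pr _ Oa) _; exact: ltry.
    exact: (w'2 _ Oa).2.
(* The component of [g1] along the normal is the coboundary of the height. *)
pose t := dot g1 n / dot n n.
have nn0 : dot n n != 0.
  apply/eqP => /eqP; rewrite dot_eq0 => /eqP n0.
  by move: na; rewrite n0 dotC dot0r => /eqP; rewrite eq_sym oner_eq0.
exists (g1 - t *: n), ((f0 \- p) \+ (fun x => t * height n x)); split.
- by rewrite dotBr dotZr dotC /t mulrVK ?subrr// unitfE.
- by apply: (locL2D S) => //; [exact: (locL2B S)|exact: (locL2_height S)].
- move=> b Ob; have := pcob b Ob; apply: filterS => x xb Ax.
  have : w b x = w' b x + (f0 (x + pi b) - f0 x) + dot g1 b by rewrite /w' addrAC subrK subrK.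
  move=> ->; rewrite (xb Ax) /= (height_shift S) (dotBl g1) dotZl mulrDr.
  move: (dot g1 b) (t * dot n b) (t * height n x) (p x) (f0 x) => y1 y2 y3 y4 y5.
  move: (p _) (f0 _) => y6 y7; ring.
Qed.

End RealCocycle.

(** * Complex-valued functions through their real and imaginary parts *)

Section ComplexNumbers.
Variable R : realType.
Implicit Types (z w : R[i]) (s t : R).
Local Open Scope complex_scope.

Lemma complex_ext z w : complex.Re z = complex.Re w -> complex.Im z = complex.Im w -> z = w.
Proof. by move=> zw1 zw2; apply/eqP; rewrite eq_complex zw1 zw2 !eqxx. Qed.

Lemma Re_add z w : complex.Re (z + w) = complex.Re z + complex.Re w.
Proof. by case: z w => ? ? []. Qed.

Lemma Im_add z w : complex.Im (z + w) = complex.Im z + complex.Im w.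
Proof. by case: z w => ? ? []. Qed.

Lemma Re_opp z : complex.Re (- z) = - complex.Re z.
Proof. by case: z. Qed.

Lemma Im_opp z : complex.Im (- z) = - complex.Im z.
Proof. by case: z. Qed.

Lemma Re_mul z w :
  complex.Re (z * w) = complex.Re z * complex.Re w - complex.Im z * complex.Im w.
Proof. by case: z w => ? ? []. Qed.

Lemma Im_mul z w :
  complex.Im (z * w) = complex.Re z * complex.Im w + complex.Im z * complex.Re w.
Proof. by case: z w => ? ? []. Qed.

Lemma Re_conjc z : complex.Re (Num.conj z) = complex.Re z.
Proof. by case: z. Qed.

Lemma Im_conjc z : complex.Im (Num.conj z) = - complex.Im z.
Proof. by case: z. Qed.

Lemma sq_normc z : Normc.normc z ^+ 2 = complex.Re z ^+ 2 + complex.Im z ^+ 2.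
Proof. by case: z => x y /=; rewrite sqr_sqrtr// addr_ge0// sqr_ge0. Qed.

Lemma normCE z : `|z| = (Normc.normc z)%:C.
Proof. by []. Qed.

Lemma normc_ge_ReIm z : `|complex.Re z| <= Normc.normc z /\ `|complex.Im z| <= Normc.normc z.
Proof.
case: z => x y /=; rewrite -!sqrtr_sqr !ler_wsqrtr//.
  by rewrite lerDr sqr_ge0.
by rewrite lerDl sqr_ge0.
Qed.

Lemma normc_le_ReIm z : Normc.normc z <= `|complex.Re z| + `|complex.Im z|.
Proof.
rewrite -(@ler_pXn2r _ 2)// ?nnegrE ?addr_ge0//; last by case: z => ? ? /=; exact: sqrtr_ge0.
rewrite sq_normc sqrrD !real_normK ?num_real// addrAC lerDl.
by rewrite mulrn_wge0// mulr_ge0.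
Qed.

Lemma expiD s t : expi (s + t) = expi s * expi t.
Proof. by apply: complex_ext; rewrite ?Re_mul ?Im_mul /= ?cosD ?sinD; ring. Qed.

Lemma expi0 : expi 0 = 1 :> R[i].
Proof. by rewrite /expi cos0 sin0. Qed.

Lemma expi_neq0 s : expi s != 0.
Proof.
apply/eqP => s0; have := expiD s (- s); rewrite subrr expi0 s0 mul0r => /eqP.
by rewrite oner_eq0.
Qed.

Lemma expiB s t : expi (s - t) = expi s / expi t.
Proof. by apply: (mulIf (expi_neq0 t)); rewrite -expiD subrK divfK ?expi_neq0. Qed.

(** For large [k] the angle [t / k.+1] lies in the open interval from [- pi] to
    [pi], where the sine only vanishes at 0. *)
Lemma expi_divisible t : (forall k, expi (t / k.+1%:R) = 1) -> t = 0.
Proof.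
move=> t1; pose k := Num.truncn (`|t| / pi).
have pi0 : 0 < pi :> R by exact: pi_gt0.
have tk : `|t / k.+1%:R| < pi.
  rewrite normrM normfV (ger0_norm (ler0n _ _)) ltr_pdivrMr ?ltr0n//.
  by rewrite mulrC -ltr_pdivrMr// truncnS_gt.
have : sin (t / k.+1%:R) = 0 by have := t1 k; case.
have [t0|t0|] := ltgtP (t / k.+1%:R) 0.
- move=> s0; have : 0 < sin (- (t / k.+1%:R)).
    apply: sin_gt0_pi; rewrite oppr_gt0 t0/=.
    by rewrite -normrN in tk; exact: le_lt_trans (ler_norm _) tk.
  by rewrite sinN s0 oppr0 ltxx.
- move=> s0; have : 0 < sin (t / k.+1%:R).
    by apply: sin_gt0_pi; rewrite t0/=; exact: le_lt_trans (ler_norm _) tk.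
  by rewrite s0 ltxx.
- by move=> /eqP; rewrite mulf_eq0 invr_eq0 pnatr_eq0 orbF => /eqP.
Qed.

Lemma Re_continuous : continuous (@complex.Re R : R[i]^o -> R).
Proof.
move=> z U /nbhs_ballP[e /= e0 eU].
apply/nbhs_ballP; exists e%:C => [|w]; first by rewrite /= ltcR.
rewrite -ball_normE/= => zw; apply: eU; rewrite -ball_normE/=.
rewrite -Re_opp -Re_add; apply: le_lt_trans (normc_ge_ReIm (z - w)).1 _.
by rewrite -ltcR.
Qed.

Lemma Im_continuous : continuous (@complex.Im R : R[i]^o -> R).
Proof.
move=> z U /nbhs_ballP[e /= e0 eU].
apply/nbhs_ballP; exists e%:C => [|w]; first by rewrite /= ltcR.
rewrite -ball_normE/= => zw; apply: eU; rewrite -ball_normE/=.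
rewrite -Im_opp -Im_add; apply: le_lt_trans (normc_ge_ReIm (z - w)).2 _.
by rewrite -ltcR.
Qed.

Definition complex_box (i : rat * rat * nat) : set R[i] :=
  [set z | ball (ratr i.1.1 : R) i.2.+1%:R^-1 (complex.Re z) /\
           ball (ratr i.1.2 : R) i.2.+1%:R^-1 (complex.Im z)].

Lemma complex_box_basis (U : set R[i]^o) z : open U -> U z ->
  exists2 i, complex_box i z & complex_box i `<=` U.
Proof.
rewrite openE => oU Uz; have /nbhs_ballP[e /= e0 eU] := oU _ Uz.
have eE : e = (complex.Re e)%:C.
  by move: e0; rewrite ltcE => /andP[/eqP ei _]; apply: complex_ext.
have r0 : 0 < complex.Re e by move: e0; rewrite ltcE => /andP[].
set r := complex.Re e in eE r0.
pose k := Num.truncn (4 / r).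
have kr : k.+1%:R^-1 < r / 4.
  by rewrite -[ltRHS]invf_div ltf_pV2 ?posrE ?divr_gt0//; exact: truncnS_gt.
have k0 : 0 < k.+1%:R^-1 :> R by rewrite invr_gt0.
have [p pz] := rat_ball (complex.Re z) k0.
have [q qz] := rat_ball (complex.Im z) k0.
exists (p, q, k); first by split; rewrite -ball_normE.
move=> w []; rewrite -!ball_normE/= => pw qw; apply: eU.
rewrite -ball_normE/= eE normCE ltcR.
apply: le_lt_trans (normc_le_ReIm _) _.
rewrite Re_add Re_opp Im_add Im_opp.
have := ler_distD (ratr p) (complex.Re z) (complex.Re w).
have := ler_distD (ratr q) (complex.Im z) (complex.Im w).
rewrite (distrC (complex.Re z) (ratr p)) (distrC (complex.Im z) (ratr q)).
have pz' : `|ratr p - complex.Re z| < r / 4 := lt_trans pz kr.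
have qz' : `|ratr q - complex.Im z| < r / 4 := lt_trans qz kr.
have pw' : `|ratr p - complex.Re w| < r / 4 := lt_trans pw kr.
have qw' : `|ratr q - complex.Im w| < r / 4 := lt_trans qw kr.
lra.
Qed.

(** An open set of complex numbers is a countable union of boxes. *)
Lemma borel_fun_complex (T : ptopologicalType) (D : set T) (p q : T -> R) :
  (forall U : set R, open U -> <<s open >> (D `&` p @^-1` U)) ->
  (forall U : set R, open U -> <<s open >> (D `&` q @^-1` U)) ->
  @borel_fun T (R[i]^o) D (fun x => p x +i* q x).
Proof.
move=> mp mq; pose T' := g_sigma_algebraType (@open T).
pose C' := g_sigma_algebraType (@open (R[i]^o)).
pose f : T' -> C' := fun x => p x +i* q x.
have mD : @measurable _ T' D by have := mp setT openT; rewrite preimage_setT setIT.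
have mf : measurable_fun (D : set T') f.
  apply: (@measurability _ _ (g_sigma_algebraType (@open T))
    (g_sigma_algebraType (@open (R[i]^o))) D f (@open (R[i]^o))) => // _ [U oU <-].
  pose F i : set T' := if `[< complex_box i `<=` U >] then
    (D `&` p @^-1` ball (ratr i.1.1 : R) i.2.+1%:R^-1) `&`
    (D `&` q @^-1` ball (ratr i.1.2 : R) i.2.+1%:R^-1) else set0.
  rewrite (_ : D `&` f @^-1` U = \bigcup_i F i).
    apply: countable_bigcupT_measurable; first exact: countableP.
    move=> i; rewrite /F; case: asboolP => // _.
    by apply: measurableI; [apply: mp|apply: mq]; exact: ball_open.
  apply/seteqP; split => x; last first.
    by move=> [i _]; rewrite /F; case: asboolP => // iU [[Dx px] [_ qx]]; split => //; exact: iU.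
  move=> [Dx Ux]; have [i ix iU] := complex_box_basis oU Ux.
  by exists i => //; rewrite /F; case: asboolP => // _; case: ix.
by move=> Y mY; exact: mf.
Qed.

Lemma borel_fun_cst (T U : topologicalType) (D : set T) (y : U) :
  <<s open >> D -> borel_fun D (fun=> y).
Proof.
move=> mD Y _; rewrite preimage_cst; case: ifP => _; first by rewrite setIT.
rewrite setI0; exact: sigma_algebra0.
Qed.

End ComplexNumbers.

Section ComplexFunctions.
Variables (R : realType) (d : nat) (P : set 'rV[R]_d) (H : zmodClosed 'rV[R]_d).
Variables (mu : {measure set (coset_space H) -> \bar R}) (A : set (coset_space H)).
Variables (n a : 'rV[R]_d) (m M : R).
Hypothesis S : omega_setting P mu A n a m M.
Local Notation E := 'rV[R]_d.
Local Notation Q := (coset_space H).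
Local Notation locL2 := (locL2 P mu A).
Implicit Types (f : Q -> R[i]).

(** Extension by 0, so that measurability on [A] becomes global. *)
Definition re_part f : Q -> R := (@complex.Re R \o f) \_ A.
Definition im_part f : Q -> R := (@complex.Im R \o f) \_ A.

Lemma re_partE f x : A x -> re_part f x = complex.Re (f x).
Proof. by move=> Ax; rewrite /re_part patchT// inE. Qed.

Lemma im_partE f x : A x -> im_part f x = complex.Im (f x).
Proof. by move=> Ax; rewrite /im_part patchT// inE. Qed.

Lemma borel_part (pr : R[i]^o -> R) f : continuous pr -> @borel_fun Q (R[i]^o) A f ->
  measurable_fun setT ((pr \o f) \_ A).
Proof.
move=> cpr bf; have mA := measurable_space S.
apply/(measurable_restrictT _ mA).
apply: (measurability _ (RGenOpens.measurableE R)).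
move=> _ [_ [s [t ->]] <-]; apply: (bf (pr @^-1` `]s, t[)).
apply: sub_gen_smallest; move/continuousP : cpr; apply; exact: interval_open.
Qed.

Lemma sq_integralE b f : measurable_fun setT (re_part f) ->
  measurable_fun setT (im_part f) ->
  (sq_integral mu A b f = sq_int mu (slab A b) (re_part f) + sq_int mu (slab A b) (im_part f))%E.
Proof.
move=> m1 m2; have mD := measurable_slab S b.
rewrite /sq_int -ge0_integralD//; last 4 first.
- by move=> x _; rewrite lee_fin sqr_ge0.
- exact: measurable_sq.
- by move=> x _; rewrite lee_fin sqr_ge0.
- exact: measurable_sq.
apply: eq_integral => x; rewrite inE => /slab_sub Ax.
by rewrite -EFinD sq_normc re_partE// im_partE.
Qed.

Lemma LA_parts f : LA P mu A f -> locL2 (re_part f) /\ locL2 (im_part f).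
Proof.
move=> [bf f2].
have m1 : measurable_fun setT (re_part f) by apply: borel_part => //; exact: Re_continuous.
have m2 : measurable_fun setT (im_part f) by apply: borel_part => //; exact: Im_continuous.
split; split => // b /f2; rewrite sq_integralE// => /(le_lt_trans _); apply.
  by rewrite leeDl// sq_int_ge0.
by rewrite leeDr// sq_int_ge0.
Qed.

Lemma LA_of_parts (p q : Q -> R) : locL2 p -> locL2 q ->
  LA P mu A (fun x => Complex (p x) (q x)).
Proof.
move=> [mp p2] [mq q2]; have mA := measurable_space S.
split.
  have mpre (g : Q -> R) (U : set R) : measurable_fun setT g -> open U ->
      measurable (A `&` g @^-1` U).
    move=> mg oU; apply: measurableI => //; rewrite -[_ @^-1` _]setTI.
    by apply: mg => //; exact: open_measurable.
  by apply: borel_fun_complex => U oU; exact: mpre.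
move=> b Ob.
have eqA (g : Q -> R) pr : (forall x, pr (Complex (p x) (q x)) = g x) ->
    sq_int mu (slab A b) ((pr \o (fun x => Complex (p x) (q x))) \_ A) =
    sq_int mu (slab A b) g.
  move=> prg; apply: eq_integral => x; rewrite inE => /slab_sub Ax.
  by rewrite patchT ?inE//= prg.
rewrite sq_integralE; last 2 first.
- by apply/(measurable_restrictT _ mA); exact: measurable_funTS.
- by apply/(measurable_restrictT _ mA); exact: measurable_funTS.
rewrite /re_part /im_part (eqA p)// (eqA q)//.
by apply: lte_add_pinfty; [exact: p2|exact: q2].
Qed.

End ComplexFunctions.

(** * The obstruction to admissibility *)

Section SquareIntegrableProduct.
Variables (d : measure_display) (T : measurableType d) (R : realType).
Variables (mu : {measure set T -> \bar R}) (D : set T).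
Hypothesis mD : measurable D.

Lemma sq_int_integrableM (f g : T -> R) :
  measurable_fun setT f -> measurable_fun setT g ->
  (sq_int mu D f < +oo)%E -> (sq_int mu D g < +oo)%E ->
  mu.-integrable D (EFin \o (fun x => f x * g x)).
Proof.
move=> mf mg f2 g2; apply/integrableP; split.
  by apply/measurable_EFinP; apply: measurable_funTS; exact: measurable_funM.
apply: (@le_lt_trans _ _ (sq_int mu D f + sq_int mu D g)%E); last exact: lte_add_pinfty.
rewrite /sq_int -ge0_integralD//; last 4 first.
- by move=> x _; rewrite lee_fin sqr_ge0.
- exact: measurable_sq.
- by move=> x _; rewrite lee_fin sqr_ge0.
- exact: measurable_sq.
apply: ge0_le_integral => //.
- apply: measurableT_comp => //; apply/measurable_EFinP.
  by apply: measurable_funTS; exact: measurable_funM.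
- by apply: emeasurable_funD; exact: measurable_sq.
move=> x _ /=; rewrite lee_fin normrM.
rewrite -(real_normK (num_real (f x))) -(real_normK (num_real (g x))).
have := sqr_ge0 (`|f x| - `|g x|); have : 0 <= `|f x| * `|g x| by rewrite mulr_ge0.
by rewrite sqrrB; lra.
Qed.

End SquareIntegrableProduct.

(** The coboundary of a 2-cochain on a commutative semigroup becomes trivial when
    it is alternated over the six orders of its three arguments. The variable
    [ab] stands for the value at [(a, b)], and [a_bc] for that at [(a, b + c)]. *)
Lemma alternating_3coboundary (F : fieldType)
    (ab ac ba bc ca cb a_bc b_ac c_ab ab_c ac_b bc_a : F) :
  ab != 0 -> ac != 0 -> ba != 0 -> bc != 0 -> ca != 0 -> cb != 0 ->
  a_bc != 0 -> b_ac != 0 -> c_ab != 0 -> ab_c != 0 -> ac_b != 0 -> bc_a != 0 ->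
  (ab * ab_c / (a_bc * bc)) / (ba * ab_c / (b_ac * ac)) *
  (bc * bc_a / (b_ac * ca)) / (cb * bc_a / (c_ab * ba)) *
  (ca * ac_b / (c_ab * ab)) / (ac * ac_b / (a_bc * cb)) = 1.
Proof. by move=> *; field; do ![apply/andP; split]. Qed.

(** The obstruction is expressed by the constants [s1] and [s2] by which a step in
    [H] changes the real and imaginary parts of [v]. *)
Section Obstruction.
Variables (R : realType) (d : nat) (P : set 'rV[R]_d) (H : zmodClosed 'rV[R]_d).
Variables (mu : {measure set (coset_space H) -> \bar R}) (A : set (coset_space H)).
Variables (n a : 'rV[R]_d) (m M : R).
Hypothesis S : omega_setting P mu A n a m M.
Local Notation E := 'rV[R]_d.
Local Notation Q := (coset_space H).
Local Notation Omega := (interior P).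
Local Notation pi := (\pi_(coset_space H)%qT).
Local Notation locL2 := (locL2 P mu A).
Implicit Types (b c h k : E) (x : Q).

Let hP := setting_cone S.
Let hmu := setting_haar S.
Let Oa := setting_interior S.

Variable v : E -> Q -> R[i].
Hypothesis vLA : forall b, Omega b -> LA P mu A (v b).
Local Notation v1 b := (re_part A (v b)).
Local Notation v2 b := (im_part A (v b)).

Let lv1 b : Omega b -> locL2 (v1 b).
Proof. by move=> /vLA /(LA_parts S)[]. Qed.

Let lv2 b : Omega b -> locL2 (v2 b).
Proof. by move=> /vLA /(LA_parts S)[]. Qed.

Definition phase b1 b2 c : R :=
  complex.Im (inner mu A (Gamma A v b1 (b2 + c)) (shift_isometry A b2 (Gamma A v b2 c))).

Definition moved_slab b c : set Q := (fun x => x - pi b) @^-1` slab A c.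

Definition phase_density b1 b2 (q x : Q) : R :=
  v2 b1 x * v1 b2 (x - q) - v1 b1 x * v2 b2 (x - q).

Lemma measurable_moved_slab b c : measurable (moved_slab b c).
Proof. by apply: measurable_translate_preimage; exact: measurable_slab S c. Qed.

Lemma moved_slab_sub b c : Omega b -> Omega c -> moved_slab b c `<=` slab A (b + c).
Proof. by move=> Ob Oc; rewrite (slabD S)//; exact: subsetUr. Qed.

Lemma phaseE b1 b2 c : Omega b1 -> Omega b2 -> Omega c ->
  phase b1 b2 c = \int[mu]_(x in moved_slab b2 c) phase_density b1 b2 (pi b2) x.
Proof.
move=> Ob1 Ob2 Oc; rewrite /phase /inner /cintegral/= Rintegral_mkcond [RHS]Rintegral_mkcond.
apply: eq_Rintegral => x _; rewrite !patchE /Gamma /shift_isometry piN.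
case: (asboolP (moved_slab b2 c x)) => [Dx|nDx].
  have Sx := moved_slab_sub Ob2 Oc Dx; have Ax := slab_sub Sx.
  have Ax2 : A (x - pi b2) := slab_sub Dx.
  rewrite !mem_set// Im_mul Re_conjc Im_conjc /phase_density.
  by rewrite !re_partE// !im_partE// mulrN addrC.
rewrite [X in _ = if X then _ else _]memNset//; case: ifP => // _.
rewrite [x - pi b2 \in slab A c]memNset// if_same.
by rewrite Im_mul Re_conjc Im_conjc !mulr0 oppr0 !mulr0 addr0.
Qed.

Lemma phase_slab b1 b2 c c' : slab A (b2 + c) = slab A (b2 + c') ->
  slab A c = slab A c' -> phase b1 b2 c = phase b1 b2 c'.
Proof. by move=> e1 e2; rewrite /phase /Gamma e1 e2. Qed.

Lemma slab_sub_lattice b h : h \in H -> slab A (b + h) = slab A b.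
Proof. by move=> hH; rewrite /slab piDh. Qed.

Lemma integrable_phase_density b1 b2 b c : Omega b1 -> Omega b2 -> Omega b -> Omega c ->
  mu.-integrable (moved_slab b c) (EFin \o phase_density b1 b2 (pi b)).
Proof.
move=> Ob1 Ob2 Ob Oc; have mD := measurable_moved_slab b c.
have Obc := omegaDD S Ob Oc.
have near (f : Q -> R) : locL2 f -> (sq_int mu (moved_slab b c) f < +oo)%E.
  move=> [mf f2]; apply: le_lt_trans (f2 _ Obc).
  apply: ge0_subset_integral => //; first exact: measurable_slab S _.
  - by apply: measurable_sq => //; exact: measurable_slab S _.
  - by move=> x _; rewrite lee_fin sqr_ge0.
  - exact: moved_slab_sub.
have far (f : Q -> R) : locL2 f ->
    (sq_int mu (moved_slab b c) (fun x => f (x - pi b))%R < +oo)%E.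
  move=> [mf f2]; apply: le_lt_trans (f2 c Oc); rewrite le_eqVlt; apply/orP; left; apply/eqP.
  apply: (@ge0_integral_translate _ _ _ _ hmu (- pi b) (slab A c) (fun x => (f x ^+ 2)%:E)).
  - exact: measurable_slab S _.
  - by apply: measurable_sq => //; exact: measurable_slab S _.
  - by move=> x _; rewrite lee_fin sqr_ge0.
have prod (f g : Q -> R) : locL2 f -> locL2 g ->
    mu.-integrable (moved_slab b c) (EFin \o (fun x => f x * g (x - pi b))).
  move=> lf lg; apply: sq_int_integrableM => //; [exact: lf.1| |exact: near|exact: far].
  by apply: measurable_shift; exact: lg.1.
rewrite (_ : EFin \o _ = (EFin \o (fun x => v2 b1 x * v1 b2 (x - pi b))%R)
  \- (EFin \o (fun x => v1 b1 x * v2 b2 (x - pi b))%R))%E.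
  by apply: integrableB => //; apply: prod; [exact: lv2|exact: lv1|exact: lv1|exact: lv2].
by apply/funext => x /=; rewrite /phase_density EFinB.
Qed.

Variables s1 s2 : E -> R.
Hypothesis v1_lattice : forall h b, h \in H -> Omega b -> Omega (b + h) ->
  {ae mu, forall x, A x -> v1 (b + h) x - v1 b x = s1 h}.
Hypothesis v2_lattice : forall h b, h \in H -> Omega b -> Omega (b + h) ->
  {ae mu, forall x, A x -> v2 (b + h) x - v2 b x = s2 h}.

(** The density is bilinear in the values of [v] at [b1] and [b2], so its second
    difference is a constant, which is integrated over a translate of the slab
    of [c]. *)
Lemma phase_second_difference h k b1 b2 c : h \in H -> k \in H ->
  Omega b1 -> Omega (b1 + h) -> Omega b2 -> Omega (b2 + k) -> Omega c ->
  phase (b1 + h) (b2 + k) c - phase (b1 + h) b2 c - phase b1 (b2 + k) c + phase b1 b2 c =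
  (s2 h * s1 k - s1 h * s2 k) * fine (mu (slab A c)).
Proof.
move=> hH kH Ob1 Ob1h Ob2 Ob2k Oc.
have Dk : moved_slab (b2 + k) c = moved_slab b2 c by rewrite /moved_slab piDh.
rewrite !phaseE// Dk piDh//.
set D := moved_slab b2 c; set q := pi b2.
have mD : measurable D := measurable_moved_slab b2 c.
have int1 := integrable_phase_density Ob1h Ob2k Ob2 Oc.
have int2 := integrable_phase_density Ob1h Ob2 Ob2 Oc.
have int3 := integrable_phase_density Ob1 Ob2k Ob2 Oc.
have int4 := integrable_phase_density Ob1 Ob2 Ob2 Oc.
have muD : mu D = mu (slab A c).
  by apply: (haar_translate hmu); exact: measurable_slab S _.
have e12 := RintegralB mD int1 int2.
have e34 := RintegralB mD int3 int4.
have int12 := integrableB mD int1 int2.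
have int34 := integrableB mD int3 int4.
have e := RintegralB mD int12 int34.
set I1 := (X in X - _ - _ + _); set I2 := (X in _ - X - _ + _).
set I3 := (X in _ - _ - X + _); set I4 := (X in _ - _ - _ + X).
rewrite (_ : I1 - I2 - I3 + I4 = (I1 - I2) - (I3 - I4)); last by ring.
rewrite -[I1 - I2]e12 -[I3 - I4]e34 -[LHS]e -muD -(Rintegral_cst mu mD); congr fine.
apply: ae_eq_integral => //.
  exact: (measurable_int mu (integrableB mD int12 int34)).
have far1 := ae_translate hmu (- q) (v1_lattice kH Ob2 Ob2k).
have far2 := ae_translate hmu (- q) (v2_lattice kH Ob2 Ob2k).
move: (ae_and (ae_and (v1_lattice hH Ob1 Ob1h) (v2_lattice hH Ob1 Ob1h)) (ae_and far1 far2)).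
apply: filterS => x [[n1 n2] [f1 f2]] Dx.
have Ax2 : A (x - q) := slab_sub Dx.
have Ax : A x := slab_sub (moved_slab_sub Ob2 Oc Dx).
rewrite /= /phase_density -(n1 Ax) -(n2 Ax) -(f1 Ax2) -(f2 Ax2).
by congr EFin; ring.
Qed.

(** The third argument enters the phase only through the slab it cuts off. *)
Lemma phase_third_lattice b1 b2 c h : h \in H -> phase b1 b2 (c + h) = phase b1 b2 c.
Proof.
by move=> hH; apply: phase_slab; [rewrite addrA|]; exact: slab_sub_lattice.
Qed.

Definition alternating_phase b1 b2 b3 : R :=
  phase b1 b2 b3 - phase b2 b1 b3 + phase b2 b3 b1 - phase b3 b2 b1
  + phase b3 b1 b2 - phase b1 b3 b2.

(** A step of the third argument of a phase changes nothing, so the second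
    difference only keeps the two terms with [c] in third position. *)
Lemma alternating_phase_second_difference h k b1 b2 c : h \in H -> k \in H ->
  Omega b1 -> Omega (b1 + h) -> Omega b2 -> Omega (b2 + k) -> Omega c ->
  alternating_phase (b1 + h) (b2 + k) c - alternating_phase (b1 + h) b2 c
    - alternating_phase b1 (b2 + k) c + alternating_phase b1 b2 c =
  2 * (s2 h * s1 k - s1 h * s2 k) * fine (mu (slab A c)).
Proof.
move=> hH kH Ob1 Ob1h Ob2 Ob2k Oc.
have d12 := phase_second_difference hH kH Ob1 Ob1h Ob2 Ob2k Oc.
have d21 := phase_second_difference kH hH Ob2 Ob2k Ob1 Ob1h Oc.
have -> : 2 * (s2 h * s1 k - s1 h * s2 k) * fine (mu (slab A c)) =
  (s2 h * s1 k - s1 h * s2 k) * fine (mu (slab A c)) -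
  (s2 k * s1 h - s1 k * s2 h) * fine (mu (slab A c)) by ring.
rewrite -d12 -d21 /alternating_phase !phase_third_lattice//.
repeat match goal with |- context [phase ?x ?y ?z] => generalize (phase x y z) end.
by move=> *; ring.
Qed.

Variable alpha : E -> E -> R[i].
Hypothesis alpha_unit : forall b c, P b -> P c -> Normc.normc (alpha b c) = 1.
Hypothesis alpha_phase : forall b1 b2 c, P b1 -> P b2 -> P c ->
  expi (phase b1 b2 c) =
  (alpha b1 b2 * alpha (b1 + b2) c) / (alpha b1 (b2 + c) * alpha b2 c).

Lemma expi_alternating_phase b1 b2 b3 : Omega b1 -> Omega b2 -> Omega b3 ->
  expi (alternating_phase b1 b2 b3) = 1.
Proof.
move=> O1 O2 O3; have [P1 P2 P3] := And3 (omega_cone O1) (omega_cone O2) (omega_cone O3).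
have al0 b c : P b -> P c -> alpha b c != 0.
  move=> Pb Pc; apply/eqP => bc0; have := alpha_unit Pb Pc.
  by rewrite bc0 Normc.normc0 => /eqP; rewrite eq_sym oner_eq0.
have PD := coneD hP.
rewrite /alternating_phase expiB expiD expiB expiD expiB !alpha_phase//.
rewrite (addrC b2 b1) (addrC b3 b1) (addrC b3 b2).
by apply: alternating_3coboundary; apply: al0 => //; exact: PD.
Qed.

(** The scaled points [a / j] make the second difference an arbitrary integral
    fraction of one real number, while its exponential stays 1. *)
Lemma phase_obstruction h k : h \in H -> k \in H -> s1 h * s2 k = s2 h * s1 k.
Proof.
move=> hH kH; apply/eqP; rewrite eq_sym -subr_eq0; apply/eqP.
have [b1 Ob1 [Ob1h _]] := omega_eventually2 S h h.
have [b2 Ob2 [Ob2k _]] := omega_eventually2 S k k.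
set kap := _ - _.
have V0 := mu_slab_gt0 S Oa.
have [V VE] : exists V : R, mu (slab A a) = V%:E.
  by exists (fine (mu (slab A a))); rewrite fineK// ge0_fin_numE ?(slab_finite S)// ltW.
rewrite VE lte_fin in V0.
have kapV : 2 * kap * V = 0.
  apply: expi_divisible => j; pose c := (j.+1%:R : R)^-1 *: a.
  have Oc : Omega c by apply: (omegaZ hP) => //; rewrite invr_gt0.
  have -> : 2 * kap * V / j.+1%:R = 2 * kap * fine (mu (slab A c)).
    have := mu_slabMn S j Oc; rewrite scalerA divff ?pnatr_eq0// scale1r VE => cV.
    have fin : mu (slab A c) \is a fin_num.
      by rewrite ge0_fin_numE// (slab_finite S).
    move: cV; rewrite -(fineK fin) -EFinM => -[->].
    by rewrite mulrA [2 * kap * _]mulrC -!mulrA [fine _ * _]mulrC mulrA; field.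
  rewrite -(alternating_phase_second_difference hH kH Ob1 Ob1h Ob2 Ob2k Oc).
  by rewrite expiD expiB expiB !expi_alternating_phase// invr1 !mulr1.
move: kapV => /eqP; rewrite !mulf_eq0 pnatr_eq0/= (gt_eqF V0) orbF => /eqP.
by [].
Qed.

End Obstruction.

(** * Decomposition and proportionality for extended cocycles *)

Section Proportional.
Variables (R : realType) (d : nat).
Implicit Types (g x y : 'rV[R]_d).

Lemma dependent_dot g1 g2 x y : ~~ free [:: g1; g2] ->
  dot g1 x * dot g2 y = dot g2 x * dot g1 y.
Proof.
rewrite free_cons seq1_free negb_and !negbK span_seq1.
move=> /orP[/vlineP[t ->]|/eqP ->]; first by rewrite !dotZl; ring.
by rewrite !(dotC 0) !dot0r; ring.
Qed.

(** By bilinearity the relation extends to the span, which contains both vectors;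
    taken at these vectors it is the equality case of Cauchy-Schwarz. *)
Lemma dependent_on_span (S : set 'rV[R]_d) g1 g2 : lspan S g1 -> lspan S g2 ->
  (forall h k, S h -> S k -> dot g1 h * dot g2 k = dot g2 h * dot g1 k) ->
  ~~ free [:: g1; g2].
Proof.
move=> [k1 [c1 [x1 [Sx1 g1E]]]] [k2 [c2 [x2 [Sx2 g2E]]]] g12.
have ext h y : S h -> lspan S y -> dot g1 h * dot g2 y = dot g2 h * dot g1 y.
  move=> Sh [k [c [s [Ss ->]]]]; rewrite !dot_sumr !mulr_sumr; apply: eq_bigr => i _.
  by rewrite !dotZr mulrCA g12// mulrCA.
have ext2 x y : lspan S x -> lspan S y -> dot g1 x * dot g2 y = dot g2 x * dot g1 y.
  move=> [k [c [s [Ss ->]]]] Ly; rewrite !dot_sumr !mulr_suml; apply: eq_bigr => i _.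
  by rewrite !dotZr -!mulrA ext.
have L1 : lspan S g1 by exists k1, c1, x1.
have L2 : lspan S g2 by exists k2, c2, x2.
rewrite free_cons seq1_free negb_and !negbK span_seq1.
have [->|g20] := eqVneq g2 0; first by rewrite orbT.
apply/orP; left; apply/vlineP; exists (dot g1 g2 / dot g2 g2).
have g22 : dot g2 g2 != 0 by rewrite dot_eq0.
apply/eqP; rewrite -subr_eq0 -dot_eq0 !dotBl !dotBr !dotZl !dotZr (dotC g2 g1).
have := ext2 _ _ L1 L2; rewrite (dotC g2 g1) => e.
apply/eqP; have -> : dot g1 g2 / dot g2 g2 * (dot g1 g2 / dot g2 g2 * dot g2 g2) =
  dot g1 g2 / dot g2 g2 * dot g1 g2 by rewrite mulfVK.
have -> : dot g1 g2 / dot g2 g2 * dot g1 g2 = dot g1 g1.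
  by rewrite mulrAC -e mulfK.
by ring.
Qed.

End Proportional.

Section ExtendedCocycle.
Variables (R : realType) (d : nat) (P : set 'rV[R]_d) (H : zmodClosed 'rV[R]_d).
Variables (mu : {measure set (coset_space H) -> \bar R}) (A : set (coset_space H)).
Variables (n a : 'rV[R]_d) (m M : R).
Hypothesis S : omega_setting P mu A n a m M.
Local Notation E := 'rV[R]_d.
Local Notation Q := (coset_space H).
Local Notation Omega := (interior P).
Local Notation pi := (\pi_(coset_space H)%qT).
Local Notation locL2 := (locL2 P mu A).
Local Notation LA := (LA P mu A).
Implicit Types (b c h k : E) (x : Q) (f : Q -> R[i]).

Let Oa := setting_interior S.
Let nL := setting_normal S.

Lemma re_part_diff f g x :
  re_part A (fun y => f y - g y) x = re_part A f x - re_part A g x.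
Proof.
rewrite /re_part !patchE; case: ifP => _; last by rewrite subr0.
by rewrite /= Re_add Re_opp.
Qed.

Lemma im_part_diff f g x :
  im_part A (fun y => f y - g y) x = im_part A f x - im_part A g x.
Proof.
rewrite /im_part !patchE; case: ifP => _; last by rewrite subr0.
by rewrite /= Im_add Im_opp.
Qed.

Lemma LA_diff f g : LA f -> LA g ->
  locL2 (re_part A (fun y => f y - g y)) /\ locL2 (im_part A (fun y => f y - g y)).
Proof.
move=> /(LA_parts S)[f1 f2] /(LA_parts S)[g1 g2]; split.
  by rewrite (_ : re_part A _ = re_part A f \- re_part A g); [exact: (locL2B S)|
    apply/funext => x; exact: re_part_diff].
by rewrite (_ : im_part A _ = im_part A f \- im_part A g); [exact: (locL2B S)|
  apply/funext => x; exact: im_part_diff].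
Qed.

Lemma LA_seminormE b f : Omega b -> locL2 (re_part A f) -> locL2 (im_part A f) ->
  ((LA_seminorm mu A b f ^+ 2)%:E =
   sq_int mu (slab A b) (re_part A f) + sq_int mu (slab A b) (im_part A f))%E.
Proof.
move=> Ob [m1 f1] [m2 f2]; rewrite -(sq_integralE S)//.
have f0 : (0 <= sq_integral mu A b f)%E.
  by apply: integral_ge0 => x _; rewrite lee_fin sqr_ge0.
rewrite sqr_sqrtr ?fine_ge0// fineK// ge0_fin_numE//.
by rewrite (sq_integralE S)//; apply: lte_add_pinfty; [exact: f1|exact: f2].
Qed.

Variables u v : E -> Q -> R[i].
Hypothesis uv : cocycle_extension P mu A u v.

Lemma extension_LA b : Omega b -> LA (v b).
Proof. by move=> /omega_cone Pb; case: uv => -[vL _] _ _; exact: vL. Qed.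

Lemma extension_cocycle b c : Omega b -> Omega c ->
  {ae mu, forall x, A x -> v (b + c) x = v b x + v c (x + pi b)}.
Proof. by move=> /omega_cone Pb /omega_cone Pc; case: uv => -[_ vD] _ _; exact: vD. Qed.

Lemma re_real_cocycle : real_cocycle P mu A (fun b => re_part A (v b)).
Proof.
split=> [b Ob|b c Ob Oc]; first by have [] := LA_parts S (extension_LA Ob).
move: (extension_cocycle Ob Oc); apply: filterS => x xbc Ax.
by rewrite !re_partE ?xbc ?Re_add//; exact: (setting_stable S Ax Ob).
Qed.

Lemma im_real_cocycle : real_cocycle P mu A (fun b => im_part A (v b)).
Proof.
split=> [b Ob|b c Ob Oc]; first by have [] := LA_parts S (extension_LA Ob).
move: (extension_cocycle Ob Oc); apply: filterS => x xbc Ax.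
by rewrite !im_partE ?xbc ?Im_add//; exact: (setting_stable S Ax Ob).
Qed.

Lemma extension_seminorm_small b (e : R) : Omega b -> 0 < e ->
  exists2 del : R, 0 < del & forall b', Omega b' -> `|b' - b| < del ->
    LA_seminorm mu A a (fun x => v b' x - v b x) ^+ 2 <= e.
Proof.
move=> Ob e0; have Pb := omega_cone Ob.
have : LA_seminorm mu A a (fun x => v b' x - v b x) @[b' --> within P (nbhs b)] --> (0 : R).
  by case: uv => _ vc _; exact: vc.
move=> /cvgr0Pnorm_lt /(_ (Num.sqrt e)).
rewrite sqrtr_gt0 => /(_ e0); rewrite /prop_near1 /within/= => /nbhs_ballP[del /= d0 bd].
exists del => // b' Ob' b'd.
have : ball b del b' by rewrite -ball_normE/= distrC.
move=> /bd /(_ (omega_cone Ob')).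
set s := LA_seminorm _ _ _ _ => se; rewrite -(sqr_sqrtr (ltW e0)) -(real_normK (num_real s)).
by rewrite lerXn2r ?nnegrE ?sqrtr_ge0// ltW.
Qed.

Let slab_continuous_part (pr : (Q -> R[i]) -> Q -> R) :
  (forall f g, pr (fun y => f y - g y) = pr f \- pr g) ->
  (forall b f, (sq_int mu (slab A b) (pr f) <= sq_int mu (slab A b) (re_part A f)
     + sq_int mu (slab A b) (im_part A f))%E) ->
  slab_continuous P mu A a (fun b => pr (v b)).
Proof.
move=> prB prle b e Ob e0; have [del d0 bd] := extension_seminorm_small Ob e0.
exists del => // b' Ob' b'd; have := bd b' Ob' b'd; rewrite -lee_fin; apply: le_trans.
have [l1 l2] := LA_diff (extension_LA Ob') (extension_LA Ob).
by rewrite LA_seminormE// -prB; exact: prle.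
Qed.

Lemma re_slab_continuous : slab_continuous P mu A a (fun b => re_part A (v b)).
Proof.
apply: slab_continuous_part => [f g|b f]; last by rewrite leeDl// sq_int_ge0.
by apply/funext => x; exact: re_part_diff.
Qed.

Lemma im_slab_continuous : slab_continuous P mu A a (fun b => im_part A (v b)).
Proof.
apply: slab_continuous_part => [f g|b f]; last by rewrite leeDr// sq_int_ge0.
by apply/funext => x; exact: im_part_diff.
Qed.

Lemma extension_decomposition : exists g1 g2 : E, exists2 F, LA F &
  [/\ lspan [set x | x \in H] g1, lspan [set x | x \in H] g2 &
    forall b, Omega b -> {ae mu, forall x, A x ->
      v b x = const_cocycle H g1 g2 b x + (F (x + pi b) - F x)}].
Proof.
have [g1 [f1 [n1 l1 e1]]] := real_cocycle_decomposition S re_real_cocycle re_slab_continuous.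
have [g2 [f2 [n2 l2 e2]]] := real_cocycle_decomposition S im_real_cocycle im_slab_continuous.
exists g1, g2, (fun x => Complex (f1 x) (f2 x)); first exact: (LA_of_parts S).
split; [exact/nL|exact/nL|move=> b Ob].
move: (ae_and (e1 b Ob) (e2 b Ob)); apply: filterS => x [x1 x2] Ax.
apply: complex_ext; first by rewrite !Re_add Re_opp/= -x1// re_partE.
by rewrite !Im_add Im_opp/= -x2// im_partE.
Qed.

Variables (g1 g2 : E) (F : Q -> R[i]).
Hypotheses (g1L : lspan [set x | x \in H] g1) (g2L : lspan [set x | x \in H] g2).
Hypothesis vF : forall b, Omega b -> {ae mu, forall x, A x ->
  v b x = const_cocycle H g1 g2 b x + (F (x + pi b) - F x)}.
Variable alpha : E -> E -> R[i].
Hypothesis alpha_unit : forall b c, P b -> P c -> Normc.normc (alpha b c) = 1.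
Hypothesis alpha_phase : forall b1 b2 c, P b1 -> P b2 -> P c ->
  expi (complex.Im (inner mu A (Gamma A v b1 (b2 + c)) (shift_isometry A b2 (Gamma A v b2 c)))) =
  (alpha b1 b2 * alpha (b1 + b2) c) / (alpha b1 (b2 + c) * alpha b2 c).

(** Coboundaries do not see a step in [H], so the lattice constants of [v] are
    those of its constant part. *)
Lemma admissible_dependent : ~~ free [:: g1; g2].
Proof.
have lat h b : h \in H -> Omega b -> Omega (b + h) -> {ae mu, forall x, A x ->
    v (b + h) x - v b x = const_cocycle H g1 g2 h x}.
  move=> hH Ob Obh; move: (ae_and (vF Ob) (vF Obh)); apply: filterS => x [x1 x2] Ax.
  rewrite x1// x2// piDh// opprD addrACA subrr addr0; apply: complex_ext.
    by rewrite Re_add Re_opp /= dotDr addrAC subrr add0r.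
  by rewrite Im_add Im_opp /= dotDr addrAC subrr add0r.
apply: (dependent_on_span g1L g2L) => h k hH kH.
apply: (phase_obstruction S extension_LA _ _ alpha_unit alpha_phase hH kH) => {}h b {}hH Ob Obh.
  move: (lat h b hH Ob Obh); apply: filterS => x xe Ax.
  by rewrite !re_partE// -Re_opp -Re_add xe.
move: (lat h b hH Ob Obh); apply: filterS => x xe Ax.
by rewrite !im_partE// -Im_opp -Im_add xe.
Qed.

End ExtendedCocycle.

(** * Constant cocycles *)

Section ConstantCocycle.
Variables (R : realType) (d : nat) (P : set 'rV[R]_d) (H : zmodClosed 'rV[R]_d).
Variables (mu : {measure set (coset_space H) -> \bar R}) (A : set (coset_space H)).
Variables (n a : 'rV[R]_d) (m M : R).
Hypothesis S : omega_setting P mu A n a m M.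
Variables g1 g2 : 'rV[R]_d.
Local Notation E := 'rV[R]_d.
Local Notation Q := (coset_space H).
Local Notation Omega := (interior P).
Local Notation LA := (LA P mu A).
Local Notation u := (const_cocycle H g1 g2).
Implicit Types (b c : E).

Lemma const_cocycle_LA b : LA (u b).
Proof. exact: (LA_of_parts S (locL2_cst S _) (locL2_cst S _)). Qed.

Lemma const_cocycleD b c x y : u (b + c) x = u b x + u c y.
Proof. by apply: complex_ext; rewrite ?Re_add ?Im_add /= dotDr. Qed.

Lemma const_cocycle_on (T : set E) : cocycle_on P mu A T u.
Proof.
split=> [b _|b c _ _]; first exact: const_cocycle_LA.
by apply: aeW => x _; exact: const_cocycleD.
Qed.

(** Integrating a constant against [xi] gives a linear form in [b], which is
    continuous. *)
Lemma const_cocycle_weak xi c : LA xi -> Omega c ->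
  @borel_fun E (R[i]^o) Omega
    (fun b => cintegral mu (slab A c) (fun x => u b x * Num.conj (xi x))).
Proof.
move=> /(LA_parts S)[lp lq] Oc; have mD := measurable_slab S c.
have int (f : Q -> R) : locL2 P mu A f -> mu.-integrable (slab A c) (EFin \o f).
  move=> [mf f2]; rewrite (_ : f = (fun x => f x * cst 1 x)); last first.
    by apply/funext => x; rewrite mulr1.
  apply: sq_int_integrableM => //; first exact: f2.
  by have [_ ->] := locL2_cst S (1 : R).
pose X1 := \int[mu]_(x in slab A c) re_part A xi x.
pose X2 := \int[mu]_(x in slab A c) im_part A xi x.
have lin (s t : R) : \int[mu]_(x in slab A c) (s * re_part A xi x + t * im_part A xi x) =
    s * X1 + t * X2.
  rewrite RintegralD//; last 2 first.
  - exact: integrableZl (int _ lp).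
  - exact: integrableZl (int _ lq).
  by rewrite !RintegralZl//; exact: int.
rewrite (_ : (fun b => _) =
  (fun b => dot (X1 *: g1 + X2 *: g2) b +i* dot (X1 *: g2 - X2 *: g1) b)%C).
  have oO : open Omega by exact: open_interior.
  have mpre (g : E) (U : set R) : open U -> <<s open >> (Omega `&` dot g @^-1` U).
    move=> oU; apply: sub_gen_smallest; apply: openI => //.
    by apply: open_comp => // x _; exact: dot_continuous.
  by apply: borel_fun_complex => U oU; exact: mpre.
apply/funext => b; apply: complex_ext.
  rewrite /= dotDl !dotZl mulrC (mulrC X2) -lin; apply: eq_Rintegral => x.
  rewrite inE => /slab_sub Ax.
  by rewrite Re_mul Re_conjc Im_conjc /= re_partE// im_partE// mulrN opprK.
rewrite /= dotBl !dotZl mulrC (mulrC X2) -mulNr -lin; apply: eq_Rintegral => x.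
rewrite inE => /slab_sub Ax.
by rewrite Im_mul Re_conjc Im_conjc /= re_partE// im_partE// mulrN mulNr addrC.
Qed.

Lemma const_cocycle_cocycle : cocycle P mu A u.
Proof. by split; [exact: const_cocycle_on|exact: const_cocycle_weak]. Qed.

(** The seminorm of a difference of values is a continuous function of the
    difference of the arguments. *)
Lemma const_cocycle_extension : cocycle_extension P mu A u u.
Proof.
split; [exact: const_cocycle_on| |by move=> b _; exact: aeW].
move=> b0 b _ Ob; 
pose V := fine (mu (slab A b)).
have semE b' : LA_seminorm mu A b (fun x => u b' x - u b0 x) =
    Num.sqrt (((dot g1 b' - dot g1 b0) ^+ 2 + (dot g2 b' - dot g2 b0) ^+ 2) * V).
  rewrite /LA_seminorm /sq_integral; congr Num.sqrt.
  rewrite (eq_integral (cst (((dot g1 b' - dot g1 b0) ^+ 2 +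
    (dot g2 b' - dot g2 b0) ^+ 2)%:E))); last first.
    by move=> x _; rewrite sq_normc Re_add Im_add Re_opp Im_opp.
  rewrite integral_cst; last exact: measurable_slab S b.
  by rewrite fineM// ge0_fin_numE// (slab_finite S).
have sq g : (dot g b' - dot g b0) ^+ 2 @[b' --> b0] --> (0 : R).
  have c1 : dot g b' @[b' --> b0] --> dot g b0 by exact: dot_continuous.
  have c2 : dot g b' - dot g b0 @[b' --> b0] --> dot g b0 - dot g b0.
    exact: (@cvgB R R^o _ _ _ (dot g) (fun=> dot g b0) _ _ c1 (cvg_cst (dot g b0))).
  rewrite subrr in c2.
  have := cvg_comp _ _ c2 (@exprn_continuous R 2 0).
  by rewrite expr0n.
have small : ((dot g1 b' - dot g1 b0) ^+ 2 + (dot g2 b' - dot g2 b0) ^+ 2) * V @[b' --> b0]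
    --> (0 : R).
  have sum := @cvgD R R^o _ _ (nbhs_filter b0) _ _ _ _ (sq g1) (sq g2).
  have cV := @cst_continuous E R V b0.
  have := @cvgM R _ _ (nbhs_filter b0) _ (fun=> V) _ _ sum cV.
  by rewrite addr0 mul0r.
have := cvg_comp _ _ small (@sqrt_continuous R 0).
rewrite sqrtr0 => small_sqrt.
rewrite (_ : (fun _ => _) = (fun b' => Num.sqrt
    (((dot g1 b' - dot g1 b0) ^+ 2 + (dot g2 b' - dot g2 b0) ^+ 2) * V))); last exact/funext.
exact: cvg_within_filter small_sqrt.
Qed.

(** The phase of the constant cocycle integrates the alternating form
    [dot g2 b1 * dot g1 b2 - dot g1 b1 * dot g2 b2], which vanishes. *)
Lemma const_cocycle_admissible : ~~ free [:: g1; g2] -> admissible P mu A u.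
Proof.
move=> g12; split; first exact: const_cocycle_cocycle.
exists u; split; first exact: const_cocycle_extension.
have [cP _ _ _ _] := setting_cone S.
exists (fun _ _ => 1); split.
- apply: borel_fun_cst; apply: closed_borel.
  rewrite (_ : P `*` P = (fst @^-1` P) `&` (snd @^-1` P))//.
  by apply: closedI; apply: closed_comp => // x _; [exact: cvg_fst|exact: cvg_snd].
- by move=> b c _ _; rewrite Normc.normc1.
move=> b1 b2 c _ _ _; rewrite !mulr1 divr1.
rewrite -expi0; congr expi; rewrite /inner /cintegral/=.
rewrite [LHS](@eq_Rintegral _ _ _ mu _ (cst 0)) ?Rintegral_cst ?mul0r//; first exact: measurable_space S.
move=> x _; rewrite /Gamma /shift_isometry.
do 3?[case: ifP => _]; rewrite ?mul0r// Im_mul Re_conjc Im_conjc ?oppr0 ?mulr0 ?addr0//=.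
by have := dependent_dot b1 b2 g12; lra.
Qed.

End ConstantCocycle.

(** * Cohomology classes *)

Section CohomologyClasses.
Variables (R : realType) (d : nat) (P : set 'rV[R]_d) (H : zmodClosed 'rV[R]_d).
Variables (mu : {measure set (coset_space H) -> \bar R}) (A : set (coset_space H)).
Variables (n a : 'rV[R]_d) (m M : R).
Hypothesis S : omega_setting P mu A n a m M.
Local Notation Q := (coset_space H).
Local Notation Omega := (interior P).
Local Notation coboundary := (coboundary P mu A).
Implicit Types (u v w : 'rV[R]_d -> Q -> R[i]).

Lemma coboundary_diff u v w : coboundary u -> coboundary v ->
  (forall b, Omega b -> {ae mu, forall x, A x -> w b x = u b x - v b x}) ->
  coboundary w.
Proof.
move=> [f lf uf] [g lg vg] wuv; have [l1 l2] := LA_diff S lf lg.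
have LAfg := LA_of_parts S l1 l2; exists (fun x => f x - g x)%R.
  case: LAfg => b2 f2; split=> [Y mY|b Ob].
    have := b2 Y mY; congr (<<s _ >> _); apply/seteqP; split => x /= [Ax].
      by rewrite re_partE// im_partE//; case: (f x - g x).
    by rewrite re_partE// im_partE//; case: (f x - g x).
  have := f2 b Ob; congr (_ < _)%E; apply: eq_integral => x; rewrite inE => /slab_sub Ax.
  by rewrite re_partE// im_partE//; case: (f x - g x).
move=> b Ob; move: (ae_and (wuv b Ob) (ae_and (uf b Ob) (vg b Ob))).
by apply: filterS => x [x1 [x2 x3]] Ax; rewrite x1// x2// x3//; ring.
Qed.

Lemma H1_class_eq u v : coboundary (fun b x => u b x - v b x) ->
  H1_class P mu A u = H1_class P mu A v.
Proof.
move=> uv; have c0 : coboundary (fun _ _ => 0).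
  by apply: (coboundary_diff uv uv) => b _; apply: aeW => x _; rewrite subrr.
have vu : coboundary (fun b x => v b x - u b x).
  by apply: (coboundary_diff c0 uv) => b _; apply: aeW => x _; rewrite sub0r opprB.
apply/seteqP; split => w [cw wc]; split => //.
  by apply: (coboundary_diff wc vu) => b _; apply: aeW => x _; rewrite opprB subrKA.
by apply: (coboundary_diff wc uv) => b _; apply: aeW => x _; rewrite opprB subrKA.
Qed.

End CohomologyClasses.

Theorem theorem5p19 (R : realType) (d : nat) (hd : (2 <= d)%N)
    (P : set 'rV[R]_d) (hP : spanning_pointed_closed_cone P)
    (H : zmodClosed 'rV[R]_d) (hH : closed [set x | x \in H])
    (hcodim : has_codim [set x | x \in H] 1)
    (mu : {measure set (coset_space H) -> \bar R}) (hmu : haar_measure mu)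
    (A : set (coset_space H)) (hA : closed_omega_space (interior P) A) :
  (forall g1 g2 : 'rV[R]_d,
      lspan [set x | x \in H] g1 -> lspan [set x | x \in H] g2 ->
      cocycle P mu A (const_cocycle H g1 g2) /\
      (admissible P mu A (const_cocycle H g1 g2) <-> ~~ free [:: g1; g2])) /\
  H1_admissible P mu A =
    [set C | exists g1 g2 : 'rV[R]_d,
       [/\ lspan [set x | x \in H] g1, lspan [set x | x \in H] g2,
           ~~ free [:: g1; g2] & C = H1_class P mu A (const_cocycle H g1 g2)]].
Proof.
have [n [a [m [M S]]]] := omega_setting_exists hP hcodim hmu hA.
split=> [g1 g2 g1L g2L|].
  split; first exact: (const_cocycle_cocycle S).
  split; last exact: (const_cocycle_admissible S).
  move=> [_ [v [uv [alpha [_ alpha1 alphaP]]]]].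
  apply: (admissible_dependent S uv (F := fun=> 0) g1L g2L _ alpha1 alphaP) => b Ob.
  have [_ _ /(_ b Ob)] := uv; apply: filterS => x vx Ax.
  by rewrite subrr addr0 vx.
apply/seteqP; split => [_ [u [cu [v [uv [alpha [_ alpha1 alphaP]]]]] <-]|_ [g1 [g2 [g1L g2L g12 ->]]]].
  have [g1 [g2 [F lF [g1L g2L vF]]]] := extension_decomposition S uv.
  exists g1, g2; split => //.
    exact: (admissible_dependent S uv g1L g2L vF alpha1 alphaP).
  apply: (H1_class_eq S); exists F => // b Ob; have [_ _ /(_ b Ob) ub] := uv.
  move: (ae_and ub (vF b Ob)); apply: filterS => x [x1 x2] Ax.
  by rewrite -x1// x2// addrAC subrr add0r.
by exists (const_cocycle H g1 g2) => //; exact: (const_cocycle_admissible S).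
Qed.
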